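(* Let $\mathbb{B}^n=(\mathbb{B}^n(t))_{t\ge0}$ be the Brownian motion on the flat torus $\mathbb{T}^n:=(\mathbb{R}/2\mathbb{Z})^n$ started at $0$, and let $\mu_{\mathbb{T}^n}$ be the uniform probability measure on $\mathbb{T}^n$. For any $c\in\mathbb{R}$, $$\lim_{n\to\infty}\mathfrak{s}\Big(\mathcal{L}\Big(\mathbb{B}^n\Big(\frac{2\log(n)}{\pi^2}+c\Big)\Big),\mu_{\mathbb{T}^n}\Big)=1-\exp\big(-2e^{-\frac{\pi^2}{2}c}\big).$$ This convergence is uniform for $c$ in every compact subset of $\mathbb{R}$, and the window of the cutoff sequence $\big(\frac{2\log(n)}{\pi^2},1\big)$ is strongly optimal.
   Context: Brownian motion on $\mathbb{T}^n$ is the projection modulo $2\mathbb{Z}$ (coordinatewise) of the standard Brownian motion $(B^1_t,\dots,B^n_t)$ on $\mathbb{R}^n$ (generator $\frac12\sum_i\partial_i^2$). $\mathcal{L}(Y)$ denotes the law of $Y$. The separation discrepancy between probability measures $\mu,\nu$ on the same measurable space is $\mathfrak{s}(\mu,\nu)=\operatorname{ess\,sup}_{\nu}\big(1-\frac{d\mu}{d\nu}\big)$, where $d\mu/d\nu$ is the Radon-Nikodym derivative of the absolutely continuous part of $\mu$ with respect to $\nu$. A family of diffusions $(X_n)$ with invariant probability measures $\mathcal{U}_n$ has an $(a_n,b_n)$ cutoff in separation, with cutoff times $(a_n)$ and window $(b_n)$, if $b_n=o(a_n)$, $\lim_{r\to\infty}\limsup_{n\to\infty}\mathfrak{s}(\mathcal{L}(X_n(a_n+rb_n)),\mathcal{U}_n)=0$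 and $\lim_{r\to\infty}\liminf_{n\to\infty}\mathfrak{s}(\mathcal{L}(X_n(a_n-rb_n)),\mathcal{U}_n)=1$. The window $(b_n)$ is strongly optimal if moreover for all $r>0$, $$0<\liminf_{n\to\infty}\mathfrak{s}(\mathcal{L}(X_n(a_n+rb_n)),\mathcal{U}_n)\le\limsup_{n\to\infty}\mathfrak{s}(\mathcal{L}(X_n(a_n-rb_n)),\mathcal{U}_n)<1.$$ *)

(* Defs.v *)
From HB Require Import structures.
From mathcomp Require Import all_boot all_order all_algebra generic_quotient.
From mathcomp Require Import all_classical all_reals all_analysis.
From mathcomp Require Import charge ess_sup_inf.

Set Implicit Arguments.
Unset Strict Implicit.
Unset Printing Implicit Defensive.

Import Order.TTheory GRing.Theory Num.Theory.
Import numFieldNormedType.Exports.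

Local Open Scope classical_set_scope.
Local Open Scope charge_scope.
Local Open Scope ring_scope.

Section circle.
Context {R : realType}.

Definition eqmod2 (x y : R) : bool := (x - y) / 2 \is a Num.int.

Lemma eqmod2_refl : reflexive eqmod2.
Proof. by move=> x; rewrite /eqmod2 subrr mul0r rpred0. Qed.

Lemma eqmod2_sym : symmetric eqmod2.
Proof. by move=> x y; rewrite /eqmod2 -opprB mulNr rpredN. Qed.

Lemma eqmod2_trans : transitive eqmod2.
Proof.
move=> y x z xy yz; rewrite /eqmod2 (_ : x - z = (x - y) + (y - z)).
  by rewrite mulrDl rpredD.
by rewrite addrA subrK.
Qed.

Canonical eqmod2_equiv := EquivRel eqmod2 eqmod2_refl eqmod2_sym eqmod2_trans.

End circle.

Definition circle (R : realType) := {eq_quot @eqmod2 R}%qT.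

HB.instance Definition _ (R : realType) := Choice.on (circle R).
HB.instance Definition _ (R : realType) :=
  EqQuotient.on (circle R).

Definition circle_proj {R : realType} (x : measurableTypeR R) : circle R :=
  (\pi_(circle R) (x : R))%qT.

Lemma circle_projP (R : realType) (x y : R) :
  reflect (circle_proj x = circle_proj y) ((x - y) / 2 \is a Num.int).
Proof. by apply: (iffP idP) => [xy|/eqmodP//]; apply/eqmodP. Qed.

HB.instance Definition _ (R : realType) :=
  isPointed.Build (circle R) (circle_proj 0).

(* The quotient sigma-algebra (final sigma-algebra for the projection), which is
   the Borel sigma-algebra of R/2Z. *)
Section circle_measurable.
Context {R : realType}.

Let circle_measurable : set (set (circle R)) :=
  image_set_system [set: measurableTypeR R] (@circle_proj R) measurable.

Let circle_measurable_sa : sigma_algebra [set: circle R] circle_measurable.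
Proof. exact/sigma_algebra_image/sigma_algebra_measurable. Qed.

Let circle_measurable0 : circle_measurable set0.
Proof. by case: circle_measurable_sa. Qed.

Let circle_measurableC A : circle_measurable A -> circle_measurable (~` A).
Proof. by case: circle_measurable_sa => _ + _ => /[apply]; rewrite setTD. Qed.

Let circle_measurable_bigcup (F : (set (circle R))^nat) :
  (forall i, circle_measurable (F i)) -> circle_measurable (\bigcup_i F i).
Proof. by case: circle_measurable_sa => _ _; exact. Qed.

HB.instance Definition _ := @isMeasurable.Build default_measure_display
  (circle R) circle_measurable
  circle_measurable0 circle_measurableC circle_measurable_bigcup.

End circle_measurable.

Lemma measurable_circle_proj (R : realType) :
  measurable_fun [set: measurableTypeR R] (@circle_proj R).
Proof. by move=> _ A. Qed.

HB.instance Definition _ (R : realType) :=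
  isMeasurableFun.Build _ _ _ _ (@circle_proj R) (@measurable_circle_proj R).

Notation torus R n := (n.-tuple (circle R)).

Definition torus_proj {R : realType} {n : nat}
    (x : n.-tuple R) : torus R n :=
  [tuple circle_proj (tnth x i) | i < n].

Section cons_pair.
Context d (T : measurableType d) (n : nat).

Definition cons_pair (p : T * n.-tuple T) : n.+1.-tuple T :=
  [tuple of p.1 :: p.2].

Lemma measurable_cons_pair : measurable_fun [set: T * n.-tuple T] cons_pair.
Proof. exact: measurable_cons. Qed.

HB.instance Definition _ :=
  isMeasurableFun.Build _ _ _ _ cons_pair measurable_cons_pair.

End cons_pair.

Fixpoint power_prob d (T : measurableType d) (R : realType)
    (P : probability T R) (n : nat) : probability (n.-tuple T) R :=
  match n with
  | 0 => \d_([tuple] : 0.-tuple T)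
  | m.+1 => distribution (P \x power_prob P m)%E (@cons_pair d T m)
  end.

Definition circle_uniform (R : realType) : probability (circle R) R :=
  distribution (uniform_prob (ltr0Sn R 1)) (@circle_proj R).

(* The n-fold product of the uniform probability on R/2Z. *)
Definition torus_uniform (R : realType) (n : nat) : probability (torus R n) R :=
  power_prob (circle_uniform R) n.

Section separation.
Context d (T : measurableType d) (R : realType).
Local Open Scope ereal_scope.
Implicit Types mu nu : probability T R.

Definition is_lebesgue_decomposition mu nu
    (ac sg : {finite_measure set T -> \bar R}) : Prop :=
  [/\ ac `<< nu,
      (exists N, [/\ measurable N, nu N = 0 & sg (~` N) = 0]) &
      forall A, measurable A -> mu A = ac A + sg A].

(* The Lebesgue decomposition of a probability measure always exists, so the
   default value [mzero] is never used; it is unique on measurable sets. *)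
Definition ac_part mu nu : {finite_measure set T -> \bar R} :=
  xget (mzero : {classic {finite_measure set T -> \bar R}})
    [set ac | exists sg, is_lebesgue_decomposition mu nu ac sg].

Definition separation mu nu : \bar R :=
  ess_sup nu
    (fun x => 1 - ('d (charge_of_finite_measure (ac_part mu nu)) '/d nu) x).

End separation.

Section cutoff.
Context (R : realType) (d : nat -> measure_display)
  (T : forall n, measurableType (d n)).
Variables (law : forall n, R -> probability (T n) R)
  (U : forall n, probability (T n) R) (a b : nat -> R).
Local Open Scope ereal_scope.

(* [law n t] stands for the law of the n-th process at time t. *)
Let sep (n : nat) (t : R) : \bar R := separation (law n t) (U n).

Definition separation_cutoff : Prop :=
  [/\ b =o_\oo a,
      limn_esup (fun n => sep n (a n + r * b n)%R) @[r --> +oo%R] --> 0 &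
      limn_einf (fun n => sep n (a n - r * b n)%R) @[r --> +oo%R] --> 1].

Definition strongly_optimal_window : Prop :=
  separation_cutoff /\
  forall r : R, (0 < r)%R ->
    [/\ 0 < limn_einf (fun n => sep n (a n + r * b n)%R),
        limn_einf (fun n => sep n (a n + r * b n)%R) <=
          limn_esup (fun n => sep n (a n - r * b n)%R) &
        limn_esup (fun n => sep n (a n - r * b n)%R) < 1].

End cutoff.

Section brownian.
Context d (Omega : measurableType d) (R : realType) (P : probability Omega R).

(* Taking some of the [A i] to be the whole line gives the product rule for
   subfamilies. *)
Definition mutually_independent (I : finType) (X : I -> Omega -> R) : Prop :=
  forall A : I -> set R, (forall i, measurable (A i)) ->
    P (\bigcap_i (X i @^-1` A i)) = (\prod_(i : I) P (X i @^-1` A i))%E.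

Definition increment {n : nat} (B : R -> Omega -> n.-tuple R) (s t : R)
    (i : 'I_n) (w : Omega) : R :=
  tnth (B t w) i - tnth (B s w) i.

(* Processes are indexed by [R], but only times [0 <= t] are constrained.
   The second parameter of [normal_prob] is the standard deviation. *)
Definition is_brownian_motion {n : nat} (B : R -> {RV P >-> n.-tuple R}) : Prop :=
  [/\ \forall w \ae P, forall i, tnth (B 0 w) i = 0,
      forall (k : nat) (t : nat -> R), 0 <= t 0%N ->
        {homo t : i j / (i < j)%N >-> i < j} ->
        mutually_independent (fun ji : 'I_k * 'I_n =>
          increment B (t ji.1) (t ji.1.+1) ji.2),
      forall (s t : R) (i : 'I_n) (A : set R), 0 <= s -> s < t -> measurable A ->
        P (increment B s t i @^-1` A) = normal_prob 0 (Num.sqrt (t - s)) A &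
      \forall w \ae P, forall i : 'I_n,
        {within `[0, +oo[, continuous (fun t => tnth (B t w) i)}].

Definition is_torus_brownian_motion {n : nat} (X : R -> {RV P >-> torus R n}) :
    Prop :=
  exists2 B : R -> {RV P >-> n.-tuple R}, is_brownian_motion B &
    forall t, 0 <= t -> forall w, X t w = torus_proj (B t w).

End brownian.

(* Main.v *)
From HB Require Import structures.
Require Import Defs.
From mathcomp Require Import all_boot all_order all_algebra.
From mathcomp Require Import all_classical all_reals all_analysis.
From mathcomp Require Import charge ess_sup_inf measurable_realfun.
From mathcomp Require Import ring lra.

Import Order.TTheory GRing.Theory Num.Theory.
Import numFieldNormedType.Exports.

Local Open Scope classical_set_scope.
Local Open Scope ring_scope.

(** Fix a time t and put q = exp(- pi^2 t / 2). The coordinates of the motion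
    are independent, so its law on the torus is the n-fold product of one law
    on the circle: the Gaussian of variance t, wrapped around R/2Z. That law
    has density

      theta(x) = 1 + 2 sum_(j >= 1) q^(j^2) cos(j pi x)

    with respect to the uniform probability ([wrapped_normal_density],
    [torus_brownian_law]), and the separation discrepancy is one minus the
    essential infimum of the product of the theta(x_i) ([separation_density]).

    Since theta(x) = 1 + 2 q cos(pi x) + O(q^2) uniformly in x, that infimum is
    (1 - 2 q + O(q^2))^n: the product is never smaller, and it is almost that
    small on the set, of positive measure, of points whose coordinates are all
    close to 1, the antipode of the origin ([torus_separation_bounds]). At time
    2 log n / pi^2 + c one has q = lam / n with lam = exp(- pi^2 c / 2), and the
    power is exp(- 2 lam) up to an error at most 20 L^2 / n if lam <= L and n is
    large compared with L ([torus_separation_estimate]). This gives the limit,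
    uniformly on compact sets of c. The limit function decreases from 1 to 0 and
    takes its values strictly between them, whence the cutoff and its strongly
    optimal window.

    The formula for the density is the Poisson summation formula for a Gaussian.
    It is proved here as an equality of measures. Both sides integrate
    cos(k pi x + a) to q^(k^2) cos a: for the Gaussian this is the computation
    of its characteristic function through a differential equation
    ([Rintegral_normal_cos]), for the theta density it is the orthogonality of
    the cosines ([theta_moment]). These integrals determine a finite measure on
    the circle ([cosine_moments_unique]): an arc is a superlevel set of some
    x |-> cos(pi (x - c)), and its indicator is a bounded limit of polynomials
    in that cosine. *)

(** * Integration against a density *)

Section density.
Context d (T : measurableType d) (R : realType).
Variables (nu : {finite_measure set T -> \bar R})
          (mu : {sigma_finite_measure set T -> \bar R}).
Variable g : T -> R.
Hypothesis mg : measurable_fun setT g.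
Hypothesis nuE :
  forall A, measurable A -> nu A = (\int[mu]_(x in A) (g x)%:E)%E.
Hypothesis g0 : forall x, 0 <= g x.

Lemma dominates_density : nu `<< mu.
Proof.
apply/null_content_dominatesP => A mA A0; rewrite nuE//.
by apply: null_set_integral => //; exact/measurable_EFinP/measurable_funTS.
Qed.

Lemma integrable_density : mu.-integrable setT (EFin \o g).
Proof.
apply/integrableP; split; first exact/measurable_EFinP.
under eq_integral do rewrite /= ger0_norm//.
by rewrite -nuE// -ge0_fin_numE// fin_num_measure.
Qed.

(** The density agrees almost everywhere with the Radon-Nikodym derivative, for
    which the change of variables is known. *)
Lemma ge0_integral_density (f : T -> \bar R) :
  measurable_fun setT f -> (forall x, 0 <= f x)%E ->
  (\int[nu]_x f x = \int[mu]_x (f x * (g x)%:E))%E.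
Proof.
move=> mf f0.
have ac := dominates_density.
rewrite -(Radon_Nikodym_SigmaFinite.change_of_variables ac f0)//.
have mRN := measurable_int mu (Radon_Nikodym_SigmaFinite.f_integrable ac).
apply: ae_eq_integral => //.
- exact: emeasurable_funM.
- by apply: emeasurable_funM => //; exact/measurable_EFinP.
apply: ae_eqe_mul2l; apply: integral_ae_eq => //.
- exact: Radon_Nikodym_SigmaFinite.f_integrable.
- exact/measurable_EFinP.
- by move=> E _ mE; rewrite -Radon_Nikodym_SigmaFinite.f_integral// nuE.
Qed.

Lemma integrable_density_mul (f : T -> R) : measurable_fun setT f ->
  nu.-integrable setT (EFin \o f) <->
  mu.-integrable setT (EFin \o (fun x => f x * g x)).
Proof.
move=> mf.
have E : (\int[nu]_x `|(EFin \o f) x| =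
          \int[mu]_x `|(EFin \o (fun x => f x * g x)%R) x|)%E.
  rewrite ge0_integral_density//; last first.
    by apply: measurableT_comp => //; exact/measurable_EFinP.
  by apply: eq_integral => x _ /=; rewrite normrM (ger0_norm (g0 x)).
split=> /integrableP[m l]; apply/integrableP; split.
- by apply/measurable_EFinP/measurable_funM.
- by rewrite -E.
- exact/measurable_EFinP.
- by rewrite E.
Qed.

Lemma integral_density (f : T -> R) : measurable_fun setT f ->
  (\int[nu]_x (f x)%:E = \int[mu]_x (f x * g x)%:E)%E.
Proof.
move=> mf; rewrite integralE [RHS]integralE; congr (_ - _)%E.
- rewrite ge0_integral_density//; last first.
    by apply/measurable_funepos/measurable_EFinP.
  apply: eq_integral => x _; rewrite !funeposE -!EFin_max -EFinM.
  by rewrite maxr_pMl// mul0r.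
- rewrite ge0_integral_density//; last first.
    by apply/measurable_funeneg/measurable_EFinP.
  apply: eq_integral => x _; rewrite !funenegE -!EFinN -!EFin_max -EFinM.
  by rewrite maxr_pMl// mul0r mulNr.
Qed.

End density.

Section density_measure.
Context d (T : measurableType d) (R : realType) (mu : {measure set T -> \bar R}).
Variable f : T -> R.

(** The two proofs are arguments so that the measure structure can be attached
    to the function of sets. *)
Definition density_measure (f0 : forall x, 0 <= f x)
    (fi : mu.-integrable setT (EFin \o f)) : set T -> \bar R :=
  fun A => (\int[mu]_(x in A) (f x)%:E)%E.

Hypotheses (f0 : forall x, 0 <= f x) (fi : mu.-integrable setT (EFin \o f)).
Local Notation m := (density_measure f0 fi).

Let m0 : m set0 = 0%E.
Proof. by rewrite /density_measure integral_set0. Qed.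

Let m_ge0 A : (0 <= m A)%E.
Proof. by apply: integral_ge0 => x _; rewrite lee_fin. Qed.

Let m_sigma_additive : semi_sigma_additive m.
Proof.
move=> F mF tF mUF; rewrite /density_measure integral_bigcup//=; last first.
  exact: (integrableS _ _ (subsetT _)).
apply: is_cvg_ereal_nneg_natsum_cond => n _ _.
by apply: integral_ge0 => x _; rewrite lee_fin.
Qed.

HB.instance Definition _ := isMeasure.Build _ _ _ m m0 m_ge0 m_sigma_additive.

Let m_finite : fin_num_fun m.
Proof.
move=> A mA; rewrite /density_measure integrable_fin_num//.
exact: (integrableS _ _ (subsetT _)).
Qed.

HB.instance Definition _ := Measure_isFinite.Build _ _ _ m m_finite.

End density_measure.

Lemma bounded_integrable d (T : measurableType d) (R : realType)
    (m : {finite_measure set T -> \bar R}) (f : T -> R) :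
  measurable_fun setT f -> (exists M, forall x, `|f x| <= M) ->
  m.-integrable setT (EFin \o f).
Proof.
move=> mf [M fM]; apply: (@le_integrable _ _ _ m _ measurableT _ (EFin \o cst M)).
- exact/measurable_EFinP.
- by move=> x _; rewrite lee_fin (le_trans (fM x))//= ler_norm.
- exact: finite_measure_integrable_cst.
Qed.

(** * The characteristic function of the normal law *)

Section derivative_line.
Variable R : realType.
Local Notation leb := (@lebesgue_measure R).

(** The boundary terms of the integrals over [-n, n] vanish in the limit. This
    is the form in which integration by parts is used on the whole line. *)
Lemma integral_derivative_line (G g : R -> R) :
  (forall x : R, is_derive x 1 G (g x)) -> continuous g ->
  leb.-integrable [set: R] (EFin \o g) ->
  G n%:R @[n --> \oo] --> 0 -> G (- n%:R) @[n --> \oo] --> 0 ->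
  (\int[leb]_x (g x)%:E = 0)%E.
Proof.
move=> dG cg ig Gy GNy.
have dG1 x : derivable G x 1 by have [] := dG x.
pose I n : set R := `[- n%:R, n%:R]%classic.
have mg : measurable_fun [set: R] g by exact: continuous_measurable_fun.
have mgI n : measurable_fun [set: R] (g \_ (I n)).
  apply/(measurable_restrictT g (measurable_itv `[- n%:R : R, n%:R])).
  exact: measurable_funTS.
have [//|||||] := @dominated_convergence _ _ _ leb setT measurableT
  (fun n => EFin \o (g \_ (I n))) (EFin \o g) (fun x => `|(g x)%:E|%E).
- by move=> n; apply/measurable_EFinP; exact: mgI.
- exact/measurable_EFinP.
- apply: aeW => x _; apply: cvg_near_cst; near=> n.
  rewrite /= patchE ifT// inE /I/= in_itv/= -ler_norml.
  by near: n; exact: nbhs_infty_ger.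
- exact: integrable_abse.
- apply: aeW => x n _ /=; rewrite patchE; case: ifP => // _.
  by rewrite normr0 lee_fin.
move=> _ _ /cvg_lim <-//; apply/cvg_lim => //.
have E n : (0 < n)%N -> (\int[leb]_x ((g \_ (I n)) x)%:E)%E =
    (G n%:R - G (- n%:R))%:E.
  move=> n0; transitivity (\int[leb]_(x in I n) (g x)%:E)%E.
    rewrite [RHS]integral_mkcond; apply: eq_integral => x _.
    by rewrite !patchE; case: ifP.
  rewrite (@continuous_FTC2 _ _ G)//.
  - by rewrite gt0_cp// ltr0n.
  - by apply: continuous_subspaceT => x; exact: cg.
  - have cG x : {for x, continuous G}.
      by apply: differentiable_continuous; exact/derivable1_diffP/dG1.
    split.
    + by move=> x _; exact: dG1.
    + by apply: cvg_at_right_filter; exact: cG.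
    + by apply: cvg_at_left_filter; exact: cG.
  - by move=> x _; rewrite derive1E; have [_ ->] := dG x.
have : (G n%:R - G (- n%:R))%:E @[n --> \oo] --> 0%:E.
  by apply: cvg_EFin; [exact: nearW|rewrite -[0 in X in _ --> X]subr0; exact: cvgB].
apply: cvg_trans; apply: near_eq_cvg; near=> n.
by apply/esym/E; near: n; exact: nbhs_infty_gt.
Unshelve. all: by end_near. Qed.

End derivative_line.
Lemma measurable_cos_affine (R : realType) (a b : R) :
  measurable_fun setT (fun x : R => cos (a * x + b)).
Proof.
apply: continuous_measurable_fun => x.
apply: continuous_comp; last exact: continuous_cos.
by apply: cvgD; [apply: cvgM; [exact: cvg_cst|exact: cvg_id]|exact: cvg_cst].
Qed.

Lemma measurable_sin_affine (R : realType) (a b : R) :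
  measurable_fun setT (fun x : R => sin (a * x + b)).
Proof.
apply: continuous_measurable_fun => x.
apply: continuous_comp; last exact: continuous_sin.
by apply: cvgD; [apply: cvgM; [exact: cvg_cst|exact: cvg_id]|exact: cvg_cst].
Qed.

Section normal_characteristic.
Variables (R : realType) (s : R).
Hypothesis s0 : s != 0.
Local Notation leb := (@lebesgue_measure R).
Local Notation p := (normal_pdf 0 s).
Local Notation N := (normal_prob 0 s).

Lemma is_derive_normal_pdf (x : R) : is_derive x 1 p (- (x / s ^+ 2) * p x).
Proof.
have E y : p y = normal_peak s * expR (- (y ^+ 2 / (s ^+ 2 *+ 2))).
  by rewrite /normal_pdf (negbTE s0) /normal_fun subr0 mulNr.
rewrite E (_ : p = fun y => normal_peak s * expR (- (y ^+ 2 / (s ^+ 2 *+ 2))));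
  last exact/funext.
apply: is_derive_eq; rewrite /GRing.scale/=.
by field.
Qed.

(** With y = x^2 / (4 s^2) the Gaussian factor is exp(- 2 y). One factor exp(- y)
    absorbs |x|, because |x| <= 1 + x^2 and x^2 = 4 s^2 y <= 4 s^2 exp(y); the
    other one is the density with standard deviation s sqrt(2). *)
Lemma normal_first_moment_bound (x : R) :
  `|x| * p x <= (1 + 4 * s ^+ 2) *
    (normal_peak s / normal_peak (s * Num.sqrt 2)) * normal_pdf 0 (s * Num.sqrt 2) x.
Proof.
have s2 : s * Num.sqrt 2 != 0 by rewrite mulf_neq0// gt_eqF// sqrtr_gt0.
have s20 : 0 < s ^+ 2 by rewrite exprn_even_gt0.
rewrite /normal_pdf (negbTE s0) (negbTE s2).
have P0 := normal_peak_gt0 s0; have P1 := normal_peak_gt0 s2.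
set a := normal_fun 0 s x; set b := normal_fun _ _ x.
have -> : (1 + 4 * s ^+ 2) * (normal_peak s / normal_peak (s * Num.sqrt 2)) *
    (normal_peak (s * Num.sqrt 2) * b) = normal_peak s * ((1 + 4 * s ^+ 2) * b).
  by field; rewrite gt_eqF.
rewrite mulrCA ler_pM2l// /a /b /normal_fun subr0.
rewrite exprMn sqr_sqrtr//; set y := x ^+ 2 / (s ^+ 2 * 4).
have y0 : 0 <= y by rewrite divr_ge0 ?sqr_ge0// mulr_ge0// ltW.
have -> : - x ^+ 2 / (s ^+ 2 *+ 2) = - y - y by rewrite /y; field.
have -> : - x ^+ 2 / (s ^+ 2 * 2 *+ 2) = - y by rewrite /y; field.
rewrite expRD mulrA ler_pM2r ?expR_gt0// expRN ler_pdivrMr ?expR_gt0//.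
apply: (@le_trans _ _ ((1 + 4 * s ^+ 2) * (1 + y))); last first.
  by rewrite ler_pM2l ?expR_ge1Dx// ltr_wpDr// mulr_ge0// ltW.
have -> : (1 + 4 * s ^+ 2) * (1 + y) = 1 + 4 * s ^+ 2 + y + x ^+ 2.
  by rewrite /y; field.
rewrite -[in leRHS](real_normK (num_real x)); nra.
Qed.

Lemma normal_probE A : measurable A -> N A = (\int[leb]_(x in A) (p x)%:E)%E.
Proof. by []. Qed.

Lemma normal_integrable_abs : N.-integrable [set: R] (EFin \o (fun x => `|x|)).
Proof.
have mp := measurable_normal_pdf 0 s.
have mn : measurable_fun [set: R] (fun x : R => `|x|) by exact: normr_measurable.
apply/(@integrable_density_mul _ _ _ N leb p mp normal_probE
  (normal_pdf_ge0 0 s) _ mn).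
pose c := (1 + 4 * s ^+ 2) * (normal_peak s / normal_peak (s * Num.sqrt 2)).
apply: (@le_integrable _ _ _ leb _ measurableT _
  (EFin \o (fun x => c * normal_pdf 0 (s * Num.sqrt 2) x))).
- exact/measurable_EFinP/measurable_funM.
- move=> x _; rewrite lee_fin [leLHS]ger0_norm ?mulr_ge0 ?normal_pdf_ge0//.
  by apply: le_trans (ler_norm _); exact: normal_first_moment_bound.
- have := integrableZl measurableT c (integrable_normal_pdf 0 (s * Num.sqrt 2)).
  by apply: eq_integrable.
Qed.

Lemma cvg_normal_pdf0 (u : nat -> R) : (forall n, u n ^+ 2 = n%:R ^+ 2) ->
  p (u n) @[n --> \oo] --> 0.
Proof.
move=> u2.
pose c : R := normal_peak s * (s ^+ 2 *+ 2).
have s20 : 0 < s ^+ 2 by rewrite exprn_even_gt0.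
apply: (@squeeze_cvgr _ _ _ _ (cst 0) (fun n => c * n%:R^-1)).
- near=> n; rewrite normal_pdf_ge0/= /normal_pdf (negbTE s0) /normal_fun subr0.
  have n1 : (1 : R) <= n%:R by rewrite ler1n; near: n; exact: nbhs_infty_gt.
  have n0 : (0 : R) < n%:R by exact: lt_le_trans n1.
  rewrite /c -mulrA ler_pM2l ?normal_peak_gt0// mulNr u2 expRN.
  have K0 : 0 < s ^+ 2 *+ 2 by rewrite pmulrn_lgt0.
  rewrite -[_ * n%:R^-1]invf_div lef_pV2 ?posrE ?expR_gt0 ?divr_gt0//.
  rewrite (le_trans _ (expR_ge1Dx _))// ler_wpDl// ler_pM2r ?invr_gt0//.
  by rewrite expr2 ler_peMr// ltW.
- exact: cvg_cst.
- rewrite -(mulr0 c); apply: cvgM; first exact: cvg_cst.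
  apply/gtr0_cvgV0; last exact: cvgr_idn.
  by near=> n; rewrite ltr0n; near: n; exact: nbhs_infty_gt.
Unshelve. all: by end_near. Qed.
Lemma Rintegral_normal (f : R -> R) : measurable_fun [set: R] f ->
  \int[N]_x f x = \int[leb]_x (f x * p x).
Proof.
move=> mf; congr fine.
exact: (@integral_density _ _ _ N leb p (measurable_normal_pdf 0 s)
  normal_probE (normal_pdf_ge0 0 s) f mf).
Qed.

Lemma integrable_normal (f : R -> R) : measurable_fun [set: R] f ->
  N.-integrable [set: R] (EFin \o f) ->
  leb.-integrable [set: R] (EFin \o (fun x => f x * p x)).
Proof.
move=> mf.
by move/(@integrable_density_mul _ _ _ N leb p (measurable_normal_pdf 0 s)
  normal_probE (normal_pdf_ge0 0 s) f mf).
Qed.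

Lemma normal_integrable_mul_sin (x a : R) :
  N.-integrable [set: R] (EFin \o (fun y => y * sin (x * y + a))).
Proof.
have ms := measurable_sin_affine R x a.
apply: le_integrable normal_integrable_abs => //.
  exact/measurable_EFinP/measurable_funM.
by move=> y _; rewrite lee_fin normr_id normrM ler_piMr// sin_max.
Qed.

Lemma normal_cos_integrable (x a : R) :
  N.-integrable [set: R] (EFin \o (fun y => cos (x * y + a))).
Proof.
apply: bounded_integrable; first exact: measurable_cos_affine.
by exists 1 => y; exact: cos_max.
Qed.

(** The derivative of sin(x y + a) p(y) is
    x cos(x y + a) p(y) - s^-2 y sin(x y + a) p(y), and its integral vanishes. *)
Lemma normal_integration_by_parts (x a : R) :
  \int[N]_y (y * sin (x * y + a)) = s ^+ 2 * x * \int[N]_y cos (x * y + a).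
Proof.
have mc := measurable_cos_affine R x a; have ms := measurable_sin_affine R x a.
have mys : measurable_fun setT (fun y : R => y * sin (x * y + a)).
  exact: measurable_funM.
rewrite !Rintegral_normal//.
have i1 := integrable_normal _ mc (normal_cos_integrable x a).
have i2 := integrable_normal _ mys (normal_integrable_mul_sin x a).
pose G y := sin (x * y + a) * p y.
pose g y := x * (cos (x * y + a) * p y) -
  (s ^+ 2)^-1 * (y * sin (x * y + a) * p y).
have dG (y : R) : is_derive y 1 G (g y).
  have dp := is_derive_normal_pdf y.
  apply: is_derive_eq; rewrite /g /GRing.scale/=.
  by field.
have cp : continuous p by exact: continuous_normal_pdf.
have cl (y : R) : {for y, continuous (fun z : R => x * z + a)}.
  by apply: cvgD; [apply: cvgM; [exact: cvg_cst|exact: cvg_id]|exact: cvg_cst].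
have cc (y : R) : {for y, continuous (fun z : R => cos (x * z + a))}.
  by apply: continuous_comp; [exact: cl|exact: continuous_cos].
have cs (y : R) : {for y, continuous (fun z : R => sin (x * z + a))}.
  by apply: continuous_comp; [exact: cl|exact: continuous_sin].
have cg : continuous g.
  move=> y; apply: cvgB; apply: cvgM; [exact: cvg_cst| |exact: cvg_cst|].
    by apply: cvgM; [exact: cc|exact: cp].
  by apply: cvgM; [apply: cvgM; [exact: cvg_id|exact: cs]|exact: cp].
have j1 := integrableZl measurableT x i1.
have j2 := integrableZl measurableT (s ^+ 2)^-1 i2.
have ig : leb.-integrable [set: R] (EFin \o g).
  by have := integrableB measurableT j1 j2; apply: eq_integrable.
have G0 (u : nat -> R) : (forall n, u n ^+ 2 = n%:R ^+ 2) ->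
    G (u n) @[n --> \oo] --> 0.
  move=> /cvg_normal_pdf0 u0; apply: norm_cvg0.
  apply: (squeeze_cvgr _ (@cvg_cst _ _ _ _ _) u0); near=> n.
  rewrite normr_ge0/= normrM (ger0_norm (normal_pdf_ge0 _ _ _)).
  by rewrite ler_piMl ?normal_pdf_ge0// sin_max.
have := integral_derivative_line _ _ _ dG cg ig (G0 _ (fun=> erefl))
  (G0 _ (fun n => sqrrN _)).
move=> /(congr1 fine) /=.
rewrite -/(Rintegral leb setT g) /g RintegralB//.
rewrite !RintegralZl// => /eqP; rewrite subr_eq0 => /eqP e.
by rewrite -mulrA e mulrA mulfV ?mul1r ?expf_neq0.
Unshelve. all: by end_near. Qed.

(** As a function of x, the integral phi satisfies phi' = - s^2 x phi, by
    differentiation under the integral followed by integration by parts; hence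
    phi(x) exp((s x)^2 / 2) is constant. Carrying the phase a treats cosines and
    sines at once. *)
Lemma Rintegral_normal_cos (x a : R) :
  \int[N]_y cos (x * y + a) = cos a * expR (- ((s * x) ^+ 2 / 2)).
Proof.
pose phi (x : R) := \int[N]_y cos (x * y + a).
have dphi (z : R) : is_derive z 1 phi (- (s ^+ 2 * z) * phi z).
  have dc (z1 y : R) : is_derive z1 1 (fun z : R => cos (z * y + a))
      (- (y * sin (z1 * y + a))).
    by apply: is_derive_eq; rewrite /GRing.scale/=; ring.
  have pE (y z1 : R) : partial1of2 (fun z y : R => cos (z * y + a)) z1 y =
      - (y * sin (z1 * y + a)).
    by rewrite partial1of2E; have [_ ->] := dc z1 y.
  have zI : `]z - 1, z + 1[%classic z.
    by rewrite /= in_itv/= ltrBlDr ltrDl ltr01.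
  have H1 (z1 : R) : `]z - 1, z + 1[%classic z1 ->
      N.-integrable [set: R] (EFin \o (fun y => cos (z1 * y + a))).
    by move=> _; exact: normal_cos_integrable.
  have H2 (z1 y : R) : `]z - 1, z + 1[%classic z1 -> [set: R] y ->
      derivable (fun z : R => cos (z * y + a)) z1 1.
    by move=> _ _; have [] := dc z1 y.
  have H3 (z1 y : R) : `]z - 1, z + 1[%classic z1 -> [set: R] y ->
      `|partial1of2 (fun z y : R => cos (z * y + a)) z1 y| <= `|y|.
    by move=> _ _; rewrite pE normrN normrM ler_piMr// sin_max.
  have D1 := @derivable_under_integral _ _ _ N (fun z y : R => cos (z * y + a))
    _ measurableT z _ _ zI H1 H2 _ (@normr_ge0 _ _) normal_integrable_abs H3.
  have D2 := @differentiation_under_integral _ _ _ N (fun z y : R => cos (z * y + a))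
    _ measurableT z _ _ zI H1 H2 _ (@normr_ge0 _ _) normal_integrable_abs H3.
  apply: DeriveDef => //; rewrite -derive1E D2.
  under eq_Rintegral do rewrite pE -mulN1r.
  rewrite RintegralZl//; last exact: normal_integrable_mul_sin.
  by rewrite normal_integration_by_parts /phi; ring.
(* the integrating factor of the differential equation *)
pose psi (z : R) := phi z * expR ((s * z) ^+ 2 / 2).
have dpsi (z : R) : is_derive z 1 psi 0.
  by apply: is_derive_eq; rewrite /GRing.scale/=; field.
have E : psi x = psi 0 by exact: is_derive_0_is_cst.
have phi0 : phi 0 = cos a.
  rewrite /phi; under eq_Rintegral do rewrite mul0r add0r.
  by rewrite Rintegral_cst//= [normal_prob _ _ _]probability_setT mulr1.
move: E; rewrite /psi mulr0 expr0n/= mul0r expR0 mulr1 phi0 => <-.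
by rewrite -mulrA -expRD subrr expR0 mulr1.
Qed.

End normal_characteristic.

(** * Cosine moments determine a measure on the circle *)

(** As n grows, the polynomials (1 - v^n)^(2^n) tend boundedly on [0, 1] to the
    indicator of v < 1/2: for 2 v < 1 by Bernoulli's inequality, since
    2^n v^n = (2 v)^n tends to 0, and for 2 v > 1 because they are at most
    exp(- (2 v)^n). *)
Section threshold_polynomials.
Variable R : realType.
Implicit Types v : R.

Lemma Bernoulli_ineq (x : R) m : 0 <= x <= 1 -> 1 - m%:R * x <= (1 - x) ^+ m.
Proof.
move=> /andP[x0 x1]; elim: m => [|m IH]; first by rewrite mul0r subr0 expr0.
rewrite exprS (le_trans _ (ler_wpM2l _ IH)) ?subr_ge0//.
rewrite -natr1; have : 0 <= m%:R * x ^+ 2 by rewrite mulr_ge0 ?sqr_ge0.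
nra.
Qed.

Lemma threshold_bound v n : 0 <= v <= 1 -> 0 <= (1 - v ^+ n) ^+ (2 ^ n) <= 1.
Proof.
move=> /andP[v0 v1].
have vn0 : 0 <= v ^+ n by rewrite exprn_ge0.
have vn1 : v ^+ n <= 1 by rewrite exprn_ile1.
by rewrite exprn_ge0 ?subr_ge0//= exprn_ile1 ?subr_ge0// lerBlDr lerDl.
Qed.

Lemma threshold_cvg1 v : 0 <= v < 1 / 2 ->
  (1 - v ^+ n) ^+ (2 ^ n) @[n --> \oo] --> (1 : R).
Proof.
move=> /andP[v0 v2].
apply: (@squeeze_cvgr _ _ _ _ (fun n => 1 - (2 * v) ^+ n) (cst 1)).
- near=> n; have v01 : 0 <= v <= 1 by rewrite v0/=; lra.
  have /andP[_ ->] := threshold_bound _ n v01; rewrite andbT exprMn.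
  rewrite -natrX; apply: Bernoulli_ineq.
  by rewrite exprn_ge0//= exprn_ile1//; lra.
- rewrite -[X in _ --> X]subr0; apply: cvgB; first exact: cvg_cst.
  by apply: cvg_expr; rewrite ger0_norm; lra.
- exact: cvg_cst.
Unshelve. all: by end_near. Qed.

Lemma threshold_cvg0 v : 1 / 2 < v <= 1 ->
  (1 - v ^+ n) ^+ (2 ^ n) @[n --> \oo] --> (0 : R).
Proof.
move=> /andP[v2 v1].
have v0 : 0 < v by lra.
apply: (@squeeze_cvgr _ _ _ _ (cst 0) (fun n => (2 * v)^-1 ^+ n)).
- near=> n; have v01 : 0 <= v <= 1 by rewrite v1 ltW.
  have /andP[-> _]/= := threshold_bound _ n v01.
  have e : 1 - v ^+ n <= expR (- v ^+ n) by exact: expR_ge1Dx.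
  have vn1 : 0 <= 1 - v ^+ n by rewrite subr_ge0 exprn_ile1// ltW.
  apply: (@le_trans _ _ (expR (- v ^+ n) ^+ (2 ^ n))).
    by apply: lerXn2r e; rewrite nnegrE ?expR_ge0.
  rewrite -expRM_natl mulrN expRN exprVn lef_pV2 ?posrE ?expR_gt0//; last first.
    by rewrite exprn_gt0// mulr_gt0.
  by rewrite natrX -exprMn (le_trans _ (expR_ge1Dx _))// lerDr.
- exact: cvg_cst.
- by apply: cvg_expr; rewrite ger0_norm ?invr_ge0 ?invf_lt1; lra.
Unshelve. all: by end_near. Qed.

End threshold_polynomials.

Section equal_integrals.
Context d (T : measurableType d) (R : realType).
Variables mu nu : {finite_measure set T -> \bar R}.

Definition equal_integrals (f : T -> R) : Prop :=
  [/\ measurable_fun setT f, exists M, forall x, `|f x| <= M &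
      \int[mu]_x f x = \int[nu]_x f x].

Lemma equal_integralsD f g : equal_integrals f -> equal_integrals g ->
  equal_integrals (fun x => f x + g x).
Proof.
move=> [mf bf ef] [mg bg eg]; split; first exact: measurable_funD.
- case: bf bg => M fM [M' gM]; exists (M + M') => x.
  by rewrite (le_trans (ler_normD _ _))// lerD.
- by rewrite !RintegralD//; [rewrite ef eg|exact: bounded_integrable..].
Qed.

Lemma equal_integralsZ k f : equal_integrals f ->
  equal_integrals (fun x => k * f x).
Proof.
move=> [mf bf ef]; split; first exact: measurable_funM.
- case: bf => M fM; exists (`|k| * M) => x.
  by rewrite normrM ler_wpM2l.
- by rewrite !RintegralZl//; [rewrite ef|exact: bounded_integrable..].
Qed.

Lemma eq_equal_integrals f g : f =1 g -> equal_integrals f -> equal_integrals g.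
Proof. by move=> /funext ->. Qed.

(** The induction on the polynomial multiplies it by the cosine of u. For this
    to go through, the claim must carry a factor cos(k u): the product of
    cos(u) and cos(k u) is a combination of cos((k - 1) u) and cos((k + 1) u). *)
Lemma equal_integrals_poly (u : T -> R) :
  (forall k : nat, equal_integrals (fun x => cos (k%:R * u x))) ->
  forall p : {poly R}, equal_integrals (fun x => p.[cos (u x)]).
Proof.
move=> H p.
suff /(_ p 0%N) : forall (p : {poly R}) (k : nat),
    equal_integrals (fun x => p.[cos (u x)] * cos (k%:R * u x)).
  by apply: eq_equal_integrals => x; rewrite mul0r cos0 mulr1.
elim/poly_ind => [|{}p c IH] k.
  apply: eq_equal_integrals (equal_integralsZ 0 _ (H 0%N)) => x.
  by rewrite mul0r horner0 mul0r.
have {}IH : equal_integrals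
    (fun x => p.[cos (u x)] * (cos (u x) * cos (k%:R * u x))).
  case: k => [|k].
    by apply: eq_equal_integrals (IH 1%N) => x; rewrite mul1r mul0r cos0 mulr1.
  apply: eq_equal_integrals
    (equal_integralsZ 2^-1 _ (equal_integralsD _ _ (IH k) (IH k.+2))) => x.
  have -> : k%:R * u x = k.+1%:R * u x - u x by rewrite -natr1; ring.
  have -> : k.+2%:R * u x = k.+1%:R * u x + u x by rewrite -natr1; ring.
  by rewrite cosB cosD; field.
apply: eq_equal_integrals (equal_integralsD _ _ IH (equal_integralsZ c _ (H k))) => x.
by rewrite hornerMXaddC; ring.
Qed.

End equal_integrals.
Section cosine_moments.
Variable R : realType.
Local Notation mR := (measurableTypeR R).

(** The difference of the two cosines is 2 sin(pi x / 2) sin(pi (b - x) / 2),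
    whose sign on ]0, 2[ is that of b - x. *)
Lemma cos_affine_threshold (b x : R) : 0 < x < 2 -> 0 < b < 2 ->
  (x < b -> cos (pi * b / 2) < cos (pi * (x - b / 2))) /\
  (b < x -> cos (pi * (x - b / 2)) < cos (pi * b / 2)).
Proof.
move=> /andP[x0 x2] /andP[b0 b2].
have p0 := pi_gt0 R.
have E : cos (pi * (x - b / 2)) - cos (pi * b / 2) =
    2 * (sin (pi * x / 2) * sin (pi * (b - x) / 2)).
  have -> : pi * (x - b / 2) = pi * x / 2 - pi * (b - x) / 2 by field.
  have -> : pi * b / 2 = pi * x / 2 + pi * (b - x) / 2 by field.
  by rewrite cosB cosD; ring.
have sx : 0 < sin (pi * x / 2).
  by apply: sin_gt0_pi; rewrite divr_gt0 ?mulr_gt0//= ltr_pdivrMr// ltr_pM2l.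
split=> xb.
  rewrite -subr_gt0 E !mulr_gt0//; apply: sin_gt0_pi.
  rewrite divr_gt0 ?mulr_gt0 ?subr_gt0//= ltr_pdivrMr// ltr_pM2l//; lra.
have sb : 0 < sin (pi * (x - b) / 2).
  apply: sin_gt0_pi.
  rewrite divr_gt0 ?mulr_gt0 ?subr_gt0//= ltr_pdivrMr// ltr_pM2l//; lra.
rewrite -subr_lt0 E (_ : pi * (b - x) / 2 = - (pi * (x - b) / 2)); last by field.
by rewrite sinN 2!mulrN oppr_lt0 !mulr_gt0.
Qed.

(** An affine image in [0, 1] of - cos(pi (x - b / 2)), placed so that it
    crosses 1/2 exactly when x crosses b. *)
Let threshold (b x : R) : R :=
  1 / 2 + (cos (pi * b / 2) - cos (pi * (x - b / 2))) / 4.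

Let threshold01 b x : 0 <= threshold b x <= 1.
Proof.
have := cos_le1 (pi * b / 2); have := cos_geN1 (pi * b / 2).
have := cos_le1 (pi * (x - b / 2)); have := cos_geN1 (pi * (x - b / 2)).
rewrite /threshold; lra.
Qed.

Let measurable_threshold b : measurable_fun [set: mR] (threshold b).
Proof.
have mc : measurable_fun [set: R] (fun x : R => cos (pi * (x - b / 2))).
  rewrite (_ : (fun _ => _) = fun x : R => cos (pi * x + - (pi * (b / 2)))).
    exact: measurable_cos_affine.
  by apply/funext => x; rewrite mulrBr.
apply: measurable_funD => //; apply: measurable_funM => //.
exact: measurable_funB.
Qed.

Lemma threshold_integral_cvg (m : {finite_measure set mR -> \bar R}) (b : R) :
  0 < b < 2 -> m (~` `]0, 2[%classic) = 0%E -> m [set b] = 0%E ->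
  \int[m]_x ((1 - threshold b x ^+ n) ^+ (2 ^ n)) @[n --> \oo] -->
  fine (m `]-oo, b[%classic).
Proof.
move=> b02 m02 mb.
have m1 : measurable ([set b] : set mR) by exact: measurable_set1.
have m2 : measurable (~` `]0, 2[%classic : set mR).
  by apply: measurableC; exact: measurable_itv.
have mray : measurable (`]-oo, b[%classic : set mR) by exact: measurable_itv.
have [//|||||] := @dominated_convergence _ _ _ m setT measurableT
  (fun n x => ((1 - threshold b x ^+ n) ^+ (2 ^ n))%:E)
  (EFin \o \1_(`]-oo, b[%classic)) (EFin \o cst 1).
- move=> n; apply/measurable_EFinP; apply: measurable_funX.
  by apply: measurable_funB => //; exact: measurable_funX.
- exact/measurable_EFinP/measurable_indic.
- exists (~` `]0, 2[%classic `|` [set b]); split.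
  + exact: measurableU.
  + exact: null_set_setU.
  + move=> x; apply: contra_notP => /not_orP[/contrapT/=].
    rewrite in_itv/= => x02 /eqP xb _.
    apply: cvg_EFin; first exact: nearW.
    have [lt gt] := cos_affine_threshold _ _ x02 b02.
    have := threshold01 b x; rewrite /comp/= indicE.
    case: (ltgtP x b) xb => // xb _ /andP[t0 t1].
    * rewrite mem_set/= ?in_itv//=; apply: threshold_cvg1.
      by rewrite t0 /threshold; have := lt xb; lra.
    * rewrite memNset/=; last by rewrite in_itv/= ltNge ltW.
      by apply: threshold_cvg0; rewrite t1 /threshold; have := gt xb; lra.
- exact: finite_measure_integrable_cst.
- apply: aeW => x n _; rewrite lee_fin.
  have /andP[h0 h1] := threshold_bound _ _ n (threshold01 b x).
  by rewrite ger0_norm.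
move=> _ _ h; have : (\int[m]_x (EFin \o \1_(`]-oo, b[%classic)) x)%E =
    m `]-oo, b[%classic.
  by rewrite integral_indic// setIT.
move=> E; rewrite E in h.
by move: h; rewrite -[m `]-oo, b[%classic]fineK ?fin_num_measure// => /fine_cvg.
Qed.

(** The measures agree on the rays ]-oo, b[. Inside ]0, 2[ such a ray is
    approximated by polynomials in cos(pi (x - b / 2)); the absence of atoms
    discards b, where they do not tend to the indicator. *)
Theorem cosine_moments_unique (mu nu : {finite_measure set mR -> \bar R}) :
  mu (~` `]0, 2[%classic) = 0%E -> nu (~` `]0, 2[%classic) = 0%E ->
  (forall b, mu [set b] = 0%E) -> (forall b, nu [set b] = 0%E) ->
  (forall (k : nat) (a : R),
    \int[mu]_x cos (k%:R * pi * x + a) = \int[nu]_x cos (k%:R * pi * x + a)) ->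
  forall A, measurable A -> mu A = nu A.
Proof.
move=> mu02 nu02 mu1 nu1 H.
have HT : mu setT = nu setT.
  have := H 0%N 0; under eq_Rintegral do rewrite !mul0r addr0 cos0.
  under [RHS]eq_Rintegral do rewrite !mul0r addr0 cos0.
  rewrite !Rintegral_cst//= !mul1r => e.
  by rewrite -[LHS]fineK ?fin_num_measure// e fineK// fin_num_measure.
have m2 : measurable (~` `]0, 2[%classic : set mR).
  by apply: measurableC; exact: measurable_itv.
have ray b : mu `]-oo, b[%classic = nu `]-oo, b[%classic.
  have [b0|b0] := leP b 0.
    have sub : `]-oo, b[%classic `<=` ~` `]0 : R, 2[%classic.
      by move=> x /=; rewrite !in_itv/= => xb; apply/negP;
        rewrite negb_and -leNgt (ltW (lt_le_trans xb b0)).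
    have null (m : {finite_measure set mR -> \bar R}) :
        m (~` `]0, 2[%classic) = 0%E -> m `]-oo, b[%classic = 0%E.
      by apply: subset_measure0 => //; exact: measurable_itv.
    by rewrite !null.
  have [b2|b2] := leP 2 b.
    have sub : ~` `]-oo, b[%classic `<=` ~` `]0 : R, 2[%classic.
      move=> x /=; rewrite !in_itv/= => /negP; rewrite -leNgt => bx.
      by apply/negP; rewrite negb_and -!leNgt (le_trans b2 bx) orbT.
    have full (m : {finite_measure set mR -> \bar R}) :
        m (~` `]0, 2[%classic) = 0%E -> m `]-oo, b[%classic = m setT.
      move=> m02; rewrite -[in RHS](setUv `]-oo, b[%classic) measureU//.
      - rewrite [X in (_ + X)%E](_ : _ = 0%E) ?adde0//.
        by apply: subset_measure0 m02 => //; apply: measurableC; exact: measurable_itv.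
      - by apply: measurableC; exact: measurable_itv.
      - exact: setICr.
    by rewrite !full.
  have b02 : 0 < b < 2 by rewrite b0.
  have c1 := threshold_integral_cvg mu b b02 mu02 (mu1 b).
  have c2 := threshold_integral_cvg nu b b02 nu02 (nu1 b).
  suff E : (fun n => \int[mu]_x ((1 - threshold b x ^+ n) ^+ (2 ^ n))) =
           (fun n => \int[nu]_x ((1 - threshold b x ^+ n) ^+ (2 ^ n))).
    rewrite E in c1; have e := cvg_unique _ c1 c2.
    by rewrite -[LHS]fineK ?fin_num_measure// e ?fineK// fin_num_measure.
  apply/funext => n.
  pose W : {poly R} := (1 / 2 + cos (pi * b / 2) / 4)%:P - (1 / 4)%:P * 'X.
  have PE x : (1 - threshold b x ^+ n) ^+ (2 ^ n) =
      ((1 - W ^+ n) ^+ (2 ^ n)).[cos (pi * (x - b / 2))].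
    rewrite !hornerE; congr ((1 - _ ^+ _) ^+ _).
    by rewrite /threshold; field.
  under eq_Rintegral do rewrite PE; under [RHS]eq_Rintegral do rewrite PE.
  suff H' k : equal_integrals _ mR R mu nu
      (fun x => cos (k%:R * (pi * (x - b / 2)))).
    by have [_ _] := equal_integrals_poly _ _ _ mu nu _ H'
      ((1 - W ^+ n) ^+ (2 ^ n)).
  have fE : (fun x : mR => cos (k%:R * (pi * (x - b / 2)))) =
            (fun x : mR => cos (k%:R * pi * x + - (k%:R * pi * (b / 2)))).
    by apply/funext => x; congr cos; ring.
  rewrite fE; split => //; first exact: measurable_cos_affine.
  by exists 1 => x; exact: cos_max.
move=> A mA.
apply: (@measure_unique _ R mR (@RGenInftyO.G R)
  (fun k : nat => `]-oo, (k%:R : R)[%classic)) => //.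
- exact: RGenInftyO.measurableE.
- move=> _ _ [x ->] [y ->]; exists (Num.min x y).
  by apply/seteqP; split => z /=; rewrite !in_itv/= lt_min => /andP.
- by move=> n; exists n%:R.
- apply/seteqP; split=> // x _; exists (Num.bound `|x|) => //=.
  by rewrite in_itv/= (le_lt_trans (ler_norm x))// archi_boundP.
- by move=> _ [x ->]; exact: ray.
- by move=> k; rewrite ltey_eq fin_num_measure.
Qed.

End cosine_moments.

(** * The theta density *)

Section theta.
Variable R : realType.
Local Notation mR := (measurableTypeR R).
Local Notation U := (uniform_prob (ltr0Sn R 1)).
Local Notation leb := (@lebesgue_measure R).

Lemma cos_add_2pi_int (x : R) (m : int) : cos (x + 2 * pi * m%:~R) = cos x.
Proof.
have nat n y : cos (y + 2 * pi * n%:R) = cos y :> R.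
  rewrite -[RHS](periodicn (@cosD2pi R) n); congr (cos (_ + _)).
  by rewrite -mulr_natr -(mulr_natr pi); ring.
case: m => n; first exact: nat.
rewrite NegzE mulrNz -[LHS](nat n.+1); congr cos.
by rewrite -pmulrn; ring.
Qed.

Definition theta_term (q x : R) (j : nat) : R :=
  q ^+ (j.+1 ^ 2) * cos (j.+1%:R * pi * x).

Definition theta_sum (q : R) (n : nat) (x : R) : R :=
  1 + 2 * series (theta_term q x) n.

Definition theta (q x : R) : R := limn (theta_sum q ^~ x).

Section bounds.
Variable q : R.
Hypothesis q0 : 0 <= q <= 1 / 2.

Lemma theta_term_bound x j : `|theta_term q x j| <= q ^+ j.+1.
Proof.
have /andP[q0' q1] := q0.
rewrite normrM ger0_norm ?exprn_ge0//.
rewrite (@le_trans _ _ (q ^+ (j.+1 ^ 2)))//.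
  by rewrite ler_piMr ?exprn_ge0// cos_max.
by apply: ler_wiXn2l; [lra|lra|rewrite -[leqLHS]expn1 leq_pexp2l].
Qed.

Lemma theta_sum_cvg x : theta_sum q n x @[n --> \oo] --> theta q x.
Proof.
have /andP[q0' q1] := q0.
suff cv : cvgn (series (theta_term q x)).
  by apply: is_cvgD; [exact: is_cvg_cst|apply: is_cvgM; [exact: is_cvg_cst|]].
apply: normed_cvg; apply: (@series_le_cvg _ _ (geometric q q)) => //.
- by move=> n; rewrite /= normr_ge0.
- by move=> n; rewrite /geometric/= mulr_ge0// exprn_ge0.
- by move=> n; rewrite /geometric/= -exprS; exact: theta_term_bound.
- by apply: is_cvg_geometric_series; rewrite ger0_norm; lra.
Qed.

(** The terms after the first one are at most those of the geometric series
    with sum q^2 / (1 - q) <= 2 q^2. Subtracting 2 q^(n+2) from the bound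
    makes the induction go through. *)
Lemma theta_sum_bound x n :
  `|theta_sum q n.+1 x - (1 + 2 * q * cos (pi * x))| <= 4 * q ^+ 2.
Proof.
have /andP[q0' q1] := q0.
suff H : `|series (theta_term q x) n.+1 - q * cos (pi * x)| <=
    2 * q ^+ 2 - 2 * q ^+ (n.+2).
  rewrite /theta_sum.
  rewrite (_ : _ - _ = 2 * (series (theta_term q x) n.+1 - q * cos (pi * x)));
    last by ring.
  have : 0 <= q ^+ n.+2 by rewrite exprn_ge0.
  rewrite normrM ger0_norm//; lra.
elim: n => [|n IH].
  rewrite /series/= big_nat1 /theta_term expr1 mul1r subrr normr0.
  by rewrite subr_ge0.
rewrite /series/= big_nat_recr//= addrAC (le_trans (ler_normD _ _))//.
have := theta_term_bound x n.+1; have := IH.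
have : 2 * q ^+ n.+3 <= q ^+ n.+2.
  by rewrite exprS mulrA ler_piMl ?exprn_ge0//; lra.
rewrite /series/=; lra.
Qed.

Lemma theta_bound x : `|theta q x - (1 + 2 * q * cos (pi * x))| <= 4 * q ^+ 2.
Proof.
have h : theta_sum q n x - (1 + 2 * q * cos (pi * x)) @[n --> \oo] -->
    theta q x - (1 + 2 * q * cos (pi * x)).
  by apply: cvgB; [exact: theta_sum_cvg|exact: cvg_cst].
have hn : `|theta_sum q n x - (1 + 2 * q * cos (pi * x))| @[n --> \oo] -->
    `|theta q x - (1 + 2 * q * cos (pi * x))| by exact: cvg_norm.
rewrite -(cvg_lim _ hn)//; apply: limr_le.
  by apply/cvg_ex; eexists; exact: hn.
near=> n; have := theta_sum_bound x n.-1.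
by rewrite prednK//; near: n; exact: nbhs_infty_gt.
Unshelve. all: by end_near. Qed.

Lemma theta_sum_le3 x n : `|theta_sum q n x| <= 3.
Proof.
have /andP[q0' q1] := q0.
case: n => [|n].
  by rewrite /theta_sum /series/= big_geq// mulr0 addr0 normr1; lra.
have := theta_sum_bound x n.
have := cos_le1 (pi * x); have := cos_geN1 (pi * x).
rewrite !ler_norml => ? ? /andP[? ?]; apply/andP; split; nra.
Qed.

Lemma measurable_theta_sum n : measurable_fun [set: mR] (theta_sum q n).
Proof.
apply: measurable_funD => //; apply: measurable_funM => //.
rewrite /series/=; apply: measurable_sum => j; apply: measurable_funM => //.
have := measurable_cos_affine R (j.+1%:R * pi) 0.
by under eq_fun do rewrite addr0.
Qed.

Lemma measurable_theta : measurable_fun [set: mR] (theta q).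
Proof.
apply: (@measurable_fun_cvg _ _ _ _ (theta_sum q)).
- by move=> n; exact: measurable_theta_sum.
- by move=> x _; exact: theta_sum_cvg.
Qed.

End bounds.

Lemma Rintegral_uniform (f : mR -> R) : measurable_fun setT f ->
  leb.-integrable `[0, 2%:R] (EFin \o f) ->
  \int[U]_x f x = 2^-1 * \int[leb]_(x in `[0, 2%:R]) f x.
Proof.
move=> mf fi; have mu := @measurable_uniform_pdf R 0 2%:R.
have u0 x : 0 <= uniform_pdf 0 (2%:R : R) x by apply: uniform_pdf_ge0.
transitivity (\int[leb]_x (f x * uniform_pdf 0 2%:R x)).
  congr fine; exact: (@integral_density _ _ _ U leb _ mu (fun _ _ => erefl) u0).
rewrite -RintegralZl//.
rewrite [RHS]Rintegral_mkcond; apply: eq_Rintegral => x _.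
rewrite patchE /uniform_pdf mem_setE in_itv/= subr0.
by case: ifP => // _; rewrite ?mulr0// mulrC.
Qed.

Lemma Rintegral_uniform_cos (m : nat) (a : R) :
  \int[U]_x cos (m%:R * pi * x + a) = (m == 0%N)%:R * cos a.
Proof.
have p0 := pi_gt0 R.
case: m => [|m].
  under eq_Rintegral do rewrite !mul0r add0r.
  by rewrite Rintegral_cst//= [uniform_prob _ _]probability_setT mulr1 mul1r.
rewrite mul0r; set c := m.+1%:R * pi.
have c0 : c != 0 by rewrite mulf_neq0 ?pnatr_eq0 ?gt_eqF.
have ccos : continuous (fun x : R => cos (c * x + a)).
  move=> x; apply: continuous_comp; last exact: continuous_cos.
  by apply: cvgD; [apply: cvgM; [exact: cvg_cst|exact: cvg_id]|exact: cvg_cst].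
have dG (x : R) : is_derive x 1 (fun x => c^-1 * sin (c * x + a)) (cos (c * x + a)).
  by apply: is_derive_eq; rewrite /GRing.scale/=; field.
have cG (x : R) : {for x, continuous (fun x => c^-1 * sin (c * x + a))}.
  by apply: differentiable_continuous; apply/derivable1_diffP; have [] := dG x.
rewrite Rintegral_uniform; [|exact: measurable_cos_affine|]; last first.
  apply: continuous_compact_integrable; first exact: segment_compact.
  exact: continuous_subspaceT.
rewrite /Rintegral (@continuous_FTC2 _ _ (fun x : R => c^-1 * sin (c * x + a)))//=.
- rewrite mulr0 add0r.
  have -> : sin (c * 2%:R + a) = sin a.
    rewrite -[RHS](periodicn (@sinD2pi R) m.+1); congr sin.
    by rewrite /c -mulr_natr -(mulr_natr pi); ring.
  by rewrite subrr mulr0.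
- exact: continuous_subspaceT.
- split; first by move=> x _; have [] := dG x.
  + by apply: cvg_at_right_filter; exact: cG.
  + by apply: cvg_at_left_filter; exact: cG.
- by move=> x _; rewrite derive1E; have [_ ->] := dG x.
Qed.

(** Product-to-sum formula; the phase a allows the frequency k - (j + 1) to be
    replaced by its absolute value when it is negative. *)
Lemma Rintegral_uniform_cos_cos (k j : nat) (a : R) :
  \int[U]_x (cos (k%:R * pi * x + a) * cos (j.+1%:R * pi * x)) =
  2^-1 * ((k == j.+1)%:R * cos a).
Proof.
pose f1 (x : mR) := cos ((k + j.+1)%:R * pi * x + a).
have [f2 [f2E mf2 bf2 If2]] : exists f2 : mR -> R,
  [/\ forall x, f2 x = cos ((k%:R * pi * x + a) - j.+1%:R * pi * x),
   measurable_fun setT f2, exists M, forall x, `|f2 x| <= M &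
   \int[U]_x f2 x = (k == j.+1)%:R * cos a].
  have [jk|kj] := leqP j.+1 k.
    exists (fun x => cos ((k - j.+1)%:R * pi * x + a)); split.
    - by move=> x; rewrite natrB//; congr cos; ring.
    - exact: measurable_cos_affine.
    - by exists 1 => x; exact: cos_max.
    - by rewrite Rintegral_uniform_cos subn_eq0 eqn_leq jk andbT.
  exists (fun x => cos ((j.+1 - k)%:R * pi * x + - a)); split.
  - move=> x; rewrite natrB ?(ltnW kj)// (_ : _ + - a =
      - (k%:R * pi * x + a - j.+1%:R * pi * x)); last by ring.
    by rewrite cosN.
  - exact: measurable_cos_affine.
  - by exists 1 => x; exact: cos_max.
  - by rewrite Rintegral_uniform_cos subn_eq0 leqNgt kj ltn_eqF// !mul0r.
transitivity (\int[U]_x (2^-1 * f1 x + 2^-1 * f2 x)).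
  apply: eq_Rintegral => x _; rewrite f2E /f1 natrD.
  rewrite (_ : (k%:R + j.+1%:R) * pi * x + a =
    (k%:R * pi * x + a) + j.+1%:R * pi * x); last by ring.
  by rewrite (cosB (k%:R * pi * x + a)) (cosD (k%:R * pi * x + a)); field.
have mf1 : measurable_fun setT f1 by exact: measurable_cos_affine.
have bf1 : exists M, forall x, `|f1 x| <= M by exists 1 => x; exact: cos_max.
have i1 := @bounded_integrable _ mR R U _ mf1 bf1.
have i2 := @bounded_integrable _ mR R U _ mf2 bf2.
rewrite RintegralD//; last 2 first.
- exact: (integrableZl measurableT 2^-1 i1).
- exact: (integrableZl measurableT 2^-1 i2).
rewrite !RintegralZl// If2 /f1 Rintegral_uniform_cos addnS/= mul0r mulr0 add0r.
by [].
Qed.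

Section moments.
Variable q : R.
Hypothesis q0 : 0 <= q <= 1 / 2.

Let mcos_theta_sum k a n :
  measurable_fun [set: mR] (fun x => cos (k%:R * pi * x + a) * theta_sum q n x).
Proof.
apply: measurable_funM; first exact: measurable_cos_affine.
exact: measurable_theta_sum.
Qed.

Let bcos_theta_sum k a n x : `|cos (k%:R * pi * x + a) * theta_sum q n x| <= 3.
Proof.
rewrite normrM (le_trans _ (theta_sum_le3 _ q0 x n))//.
by rewrite ler_piMl// cos_max.
Qed.

Lemma theta_sum_moment (k : nat) (a : R) (n : nat) :
  \int[U]_x (cos (k%:R * pi * x + a) * theta_sum q n x) =
  (k <= n)%:R * (q ^+ (k ^ 2) * cos a).
Proof.
elim: n => [|n IH].
  under eq_Rintegral do rewrite /theta_sum /series/= big_geq// mulr0 addr0 mulr1.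
  rewrite Rintegral_uniform_cos leqn0.
  by case: eqP => [->|_]; rewrite /= ?mul0r// exp0n// expr0 !mul1r.
have E (x : mR) : cos (k%:R * pi * x + a) * theta_sum q n.+1 x =
    cos (k%:R * pi * x + a) * theta_sum q n x +
    2 * q ^+ (n.+1 ^ 2) * (cos (k%:R * pi * x + a) * cos (n.+1%:R * pi * x)).
  rewrite /theta_sum /series/= big_nat_recr//= /theta_term; ring.
under eq_Rintegral do rewrite E.
have mcc : measurable_fun [set: mR]
    (fun x => cos (k%:R * pi * x + a) * cos (n.+1%:R * pi * x)).
  apply: measurable_funM; first exact: measurable_cos_affine.
  have := measurable_cos_affine R (n.+1%:R * pi) 0.
  by under eq_fun do rewrite addr0.
have icc : U.-integrable [set: mR]
    (EFin \o (fun x => cos (k%:R * pi * x + a) * cos (n.+1%:R * pi * x))).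
  apply: (@bounded_integrable _ mR R U) => //; exists 1 => x.
  by rewrite normrM mulr_ile1// cos_max.
rewrite RintegralD//; last first.
- exact: (integrableZl measurableT (2 * q ^+ (n.+1 ^ 2)) icc).
- by apply: (@bounded_integrable _ mR R U) => //; exists 3 => x.
rewrite IH RintegralZl// Rintegral_uniform_cos_cos (leq_eqVlt k n.+1) ltnS.
case: eqP => [->|_]; last by rewrite mul0r !mulr0 addr0.
by rewrite ltnn/=; field.
Qed.

Lemma theta_moment (k : nat) (a : R) :
  \int[U]_x (cos (k%:R * pi * x + a) * theta q x) = q ^+ (k ^ 2) * cos a.
Proof.
have mth := measurable_theta _ q0.
have [//|||||] := @dominated_convergence _ _ _ U setT measurableT
  (fun n x => (cos (k%:R * pi * x + a) * theta_sum q n x)%:E)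
  (fun x => (cos (k%:R * pi * x + a) * theta q x)%:E) (EFin \o cst 3).
- by move=> n; apply/measurable_EFinP; exact: mcos_theta_sum.
- apply/measurable_EFinP; apply: measurable_funM => //.
  exact: measurable_cos_affine.
- apply: aeW => x _; apply: cvg_EFin; first exact: nearW.
  by apply: cvgM; [exact: cvg_cst|exact: theta_sum_cvg].
- exact: finite_measure_integrable_cst.
- by apply: aeW => x n _; rewrite lee_fin bcos_theta_sum.
move=> i _ h; have : (\int[U]_x (cos (k%:R * pi * x + a) * theta_sum q n x)%:E)%E
    @[n --> \oo] --> (q ^+ (k ^ 2) * cos a)%:E.
  apply: cvg_near_cst; near=> n.
  have ic : U.-integrable [set: mR]
      (EFin \o (fun x => cos (k%:R * pi * x + a) * theta_sum q n x)).
    by apply: (@bounded_integrable _ mR R U) => //; exists 3 => x.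
  rewrite -(fineK (integrable_fin_num measurableT ic)); congr EFin.
  rewrite [LHS]theta_sum_moment (_ : (k <= n)%N) ?mul1r//.
  by near: n; exact: nbhs_infty_ge.
move=> h'; rewrite /Rintegral.
rewrite (_ : (\int[U]_x _)%E = (q ^+ (k ^ 2) * cos a)%:E)//.
exact: (cvg_unique _ h h').
Unshelve. all: by end_near. Qed.

End moments.

End theta.
Arguments theta_term {R}.
Arguments theta_sum {R}.
Arguments theta {R}.

(** * The law of a wrapped Gaussian *)

Section wrapped_normal.
Variable R : realType.
Local Notation mR := (measurableTypeR R).
Local Notation U := (uniform_prob (ltr0Sn R 1)).
Local Notation leb := (@lebesgue_measure R).

(** The representative in [0, 2[ of x modulo 2. *)
Definition wrap (x : mR) : mR := (x : R) - 2 * (Num.floor ((x : R) / 2))%:~R.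

Lemma wrap_itv (x : R) : 0 <= (wrap x : R) < 2.
Proof.
have /andP[] := floor_itv (x / 2); rewrite /wrap intrD; lra.
Qed.

Lemma measurable_wrap : measurable_fun [set: mR] wrap.
Proof.
apply: (@measurable_funB _ _ R setT (fun x => x)) => //.
apply: measurable_funM => //; apply: nondecreasing_measurable => // x y xy.
by rewrite ler_int le_floor// ler_pM2r.
Qed.

HB.instance Definition _ := isMeasurableFun.Build _ _ _ _ wrap measurable_wrap.

Lemma circle_proj_wrap (x : R) : circle_proj (wrap x) = circle_proj x :> circle R.
Proof.
apply/circle_projP; rewrite /wrap.
rewrite (_ : _ / 2 = - (Num.floor (x / 2))%:~R); last by field.
by rewrite rpredN intr_int.
Qed.

Lemma cos_wrap (k : nat) (a x : R) :
  cos (k%:R * pi * wrap x + a) = cos (k%:R * pi * x + a).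
Proof.
rewrite -[RHS](cos_add_2pi_int _ _ (- (k%:Z * Num.floor (x / 2)))); congr cos.
by rewrite /wrap mulrNz intrM; ring.
Qed.

Lemma theta_periodic (q x y : R) : (x - y) / 2 \is a Num.int ->
  theta q x = theta q y.
Proof.
move=> /intrP[m xy]; have -> : x = y + 2 * m%:~R by rewrite -xy; field.
suff E : theta_term q (y + 2 * m%:~R) = theta_term q y by rewrite /theta /theta_sum E.
apply/funext => j; rewrite /theta_term; congr (_ * _).
rewrite -[RHS](cos_add_2pi_int _ _ (j.+1%:Z * m)); congr cos.
by rewrite intrM; ring.
Qed.

Lemma uniform_countable0 (A : set mR) : measurable A -> countable A -> U A = 0%E.
Proof.
move=> mA cA; have /null_content_dominatesP h := dominates_uniform_prob (ltr0Sn R 1).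
by apply: h => //; exact: countable_lebesgue_measure0.
Qed.

Lemma normal_countable0 (s : R) (A : set mR) :
  measurable A -> countable A -> normal_prob 0 s A = 0%E.
Proof.
move=> mA cA; have /null_content_dominatesP h := normal_prob_dominates 0 s.
by apply: h => //; exact: countable_lebesgue_measure0.
Qed.

Lemma countable_wrap_preimage (b : R) : countable (wrap @^-1` [set b]).
Proof.
apply: (@sub_countable _ _ _ (range (fun k : int => b + 2 * k%:~R))).
  apply: subset_card_le => x /= <-; exists (Num.floor ((x : R) / 2)) => //.
  by rewrite /wrap subrK.
by apply: sub_countable (card_image_le _ _) _; exact: countableP.
Qed.

Variables s q : R.
Hypotheses (s0 : s != 0) (qE : q = expR (- ((pi * s) ^+ 2 / 2))).
Hypothesis q4 : q <= 1 / 4.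
Local Notation N := (normal_prob 0 s).

Let q02 : 0 <= q <= 1 / 2.
Proof.
have := expR_ge0 (- ((pi * s) ^+ 2 / 2)); rewrite -qE => q0.
by rewrite q0/= (le_trans q4)//; lra.
Qed.

Lemma theta_ge0 x : 0 <= theta q x.
Proof.
have := theta_bound _ _ q02 x; rewrite ler_norml => /andP[+ _].
have := cos_geN1 (pi * x); have /andP[? _] := q02; have := q4; nra.
Qed.

Lemma theta_le3 x : theta q x <= 3.
Proof.
have := theta_bound _ _ q02 x; rewrite ler_norml => /andP[_ +].
have := cos_le1 (pi * x); have /andP[? _] := q02; have := q4; nra.
Qed.

Let mtheta := measurable_theta _ _ q02.

Lemma theta_integrable : U.-integrable [set: mR] (EFin \o theta q).
Proof.
apply: bounded_integrable => //; exists 3 => x.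
by rewrite ger0_norm ?theta_ge0// theta_le3.
Qed.

Let nu := @density_measure _ mR R U (theta q) theta_ge0 theta_integrable.

(** [cosine_moments_unique] applies to the wrapped Gaussian and to the measure
    with density theta: both give full mass to ]0, 2[ and have no atoms,
    because countable sets are null for the Gaussian and for the uniform law. *)
Lemma wrapped_normal_density (A : set mR) : measurable A ->
  N (wrap @^-1` A) = (\int[U]_(x in A) (theta q x)%:E)%E.
Proof.
move=> mA.
have nuac B : measurable B -> U B = 0%E -> nu B = 0%E.
  move=> mB B0; apply: null_set_integral => //.
  exact/measurable_EFinP/measurable_funTS.
have ms b : measurable ([set b] : set mR) by exact: measurable_set1.
have mw B : measurable B -> measurable (wrap @^-1` B).
  by move=> mB; rewrite -[X in measurable X]setTI; exact: measurable_wrap.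
have moo : measurable (~` `]0, 2[%classic : set mR).
  by apply: measurableC; exact: measurable_itv.
apply: (@cosine_moments_unique R (distribution N wrap) nu) => //.
- change (N (wrap @^-1` (~` `]0, 2[%classic)) = 0%E).
  apply: (@subset_measure0 _ _ _ N _ (wrap @^-1` [set 0])).
  + exact: mw.
  + exact: mw.
  + move=> x /=; rewrite in_itv/= => /negP; have /andP[x0 ->] := wrap_itv x.
    by rewrite andbT -leNgt => x0'; apply/eqP; rewrite eq_le x0' x0.
  + by apply: normal_countable0; [exact: mw|exact: countable_wrap_preimage].
- apply: nuac => //; rewrite /uniform_prob integral_uniform_pdf.
  apply: null_set_integral.
  + by apply: measurableI => //; exact: measurable_itv.
  + by apply/measurable_EFinP/measurable_funTS; exact: measurable_uniform_pdf.
  + apply: (@subset_measure0 _ _ _ leb _ ([set 0; 2] : set R)).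
    * by apply: measurableI => //; exact: measurable_itv.
    * by apply: measurableU; exact: measurable_set1.
    * move=> x /=; rewrite !in_itv/= => -[/negP + /andP[x0 x2]].
      rewrite negb_and -!leNgt => /orP[?|?]; [left|right]; apply/eqP.
        by rewrite eq_le x0 andbT.
      by rewrite eq_le x2.
    * by apply: countable_lebesgue_measure0; exact: finite_set_countable.
- by move=> b; apply: normal_countable0; [exact: mw|exact: countable_wrap_preimage].
- by move=> b; apply: nuac => //; exact: uniform_countable0.
move=> k a.
have mc := measurable_cos_affine R (k%:R * pi) a.
transitivity (\int[N]_x cos (k%:R * pi * x + a)).
  rewrite /Rintegral integral_distribution//.
  - by congr fine; apply: eq_integral => x _ /=; rewrite cos_wrap.
  - exact/measurable_EFinP.
  - apply: (@bounded_integrable _ mR R N (fun x => cos (k%:R * pi * wrap x + a))).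
      by rewrite (_ : (fun _ => _) = fun x : mR => cos (k%:R * pi * x + a))//;
        apply/funext => x; exact: cos_wrap.
    by exists 1 => x; exact: cos_max.
rewrite Rintegral_normal_cos//.
transitivity (\int[U]_x (cos (k%:R * pi * x + a) * theta q x)); last first.
  congr fine; apply/esym.
  exact: (@integral_density _ _ _ nu U _ mtheta (fun _ _ => erefl) theta_ge0 _ mc).
(* the exponent of the k-th moment is k^2 times that of q *)
rewrite theta_moment// mulrC qE -expRM_natl; congr (expR _ * _).
by rewrite natrX; field.
Qed.

End wrapped_normal.

(** * Product measures on tuples *)

Section power_prob.
Context d (T : measurableType d) (R : realType).

Lemma measurable_prod_tnth n (f : 'I_n -> T -> R) :
  (forall i, measurable_fun setT (f i)) ->
  measurable_fun setT (fun t : n.-tuple T => \prod_(i < n) f i (tnth t i)).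
Proof.
move=> mf; apply: measurable_prod => i _.
by apply: measurableT_comp => //; exact: measurable_tnth.
Qed.

Lemma ge0_integral_power_prob (P : probability T R) n (f : 'I_n -> T -> R) :
  (forall i, measurable_fun setT (f i)) -> (forall i x, 0 <= f i x) ->
  (\int[power_prob P n]_t (\prod_(i < n) f i (tnth t i))%:E =
   \prod_(i < n) \int[P]_x (f i x)%:E)%E.
Proof.
elim: n f => [|n IH] f mf f0.
  rewrite big_ord0; under eq_integral do rewrite big_ord0.
  by rewrite integral_cst// mul1e [LHS]probability_setT.
have mF := measurable_prod_tnth _ _ mf.
rewrite /= ge0_integral_distribution; last 2 first.
- exact/measurable_EFinP.
- by move=> t; rewrite lee_fin prodr_ge0.
have E (p : T * n.-tuple T) :
    \prod_(i < n.+1) f i (tnth (cons_pair p) i) =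
    f ord0 p.1 * \prod_(i < n) f (lift ord0 i) (tnth p.2 i).
  rewrite big_ord_recl /=; congr (f _ _ * _).
  by apply: eq_bigr => i _; rewrite /cons_pair tnthS.
transitivity (\int[P \x power_prob P n]_p
   (f ord0 p.1 * \prod_(i < n) f (lift ord0 i) (tnth p.2 i))%:E)%E.
  by apply: eq_integral => p _; rewrite /= E.
have mf' : forall i : 'I_n, measurable_fun setT (f (lift ord0 i)) by [].
have mF' := measurable_prod_tnth _ _ mf'.
rewrite fubini_tonelli1; last 2 first.
- apply/measurable_EFinP; apply: measurable_funM.
    by apply: measurableT_comp => //; exact: measurable_fst.
  exact: (measurableT_comp mF' measurable_snd).
- by move=> p; rewrite lee_fin mulr_ge0// prodr_ge0.
rewrite /fubini_F /=.
under eq_integral => x _.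
  under eq_integral do rewrite EFinM.
  rewrite ge0_integralZl//; last 3 first.
  - exact/measurable_EFinP.
  - by move=> t _; rewrite lee_fin prodr_ge0.
  - by rewrite lee_fin.
  rewrite (IH (fun i => f (lift ord0 i)))//.
  over.
rewrite ge0_integralZr//; last 3 first.
- exact/measurable_EFinP.
- by move=> x _; rewrite lee_fin.
- by apply: prode_ge0 => i _; apply: integral_ge0 => x _; rewrite lee_fin.
by rewrite big_ord_recl.
Qed.

Definition rectangle n (A : 'I_n -> set T) : set (n.-tuple T) :=
  [set t | forall i, A i (tnth t i)].

Lemma indic_rectangle n (A : 'I_n -> set T) (t : n.-tuple T) :
  \1_(rectangle n A) t = \prod_(i < n) \1_(A i) (tnth t i) :> R.
Proof.
rewrite indicE; case: (boolP (t \in _)) => [|tA].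
  rewrite inE => tA; rewrite big1// => i _.
  by rewrite indicE mem_set.
have [i tAi] : exists i, ~ A i (tnth t i).
  by apply/existsNP => h; move/negP: tA; apply; rewrite inE.
by rewrite (bigD1 i)//= indicE memNset// mul0r.
Qed.

Lemma measurable_rectangle n (A : 'I_n -> set T) :
  (forall i, measurable (A i)) -> measurable (rectangle n A).
Proof.
move=> mA.
rewrite (_ : rectangle n A =
    \bigcap_(i in [set: 'I_n]) ((fun t : n.-tuple T => tnth t i) @^-1` A i)).
  apply: fin_bigcap_measurable => // i _.
  by rewrite -[X in measurable X]setTI; exact: measurable_tnth.
by apply/seteqP; split=> t h i => [_|]; exact: h.
Qed.

(** Rectangles are stable under intersection and generate the sigma-algebra,
    the generators being the rectangles with a single proper side. *)
Lemma rectangle_unique n (mu nu : {finite_measure set (n.-tuple T) -> \bar R}) :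
  (forall A : 'I_n -> set T, (forall i, measurable (A i)) ->
     mu (rectangle n A) = nu (rectangle n A)) ->
  forall A, measurable A -> mu A = nu A.
Proof.
move=> H A mA.
apply: (@measure_unique _ R (n.-tuple T)
  [set rectangle n B | B in [set B : 'I_n -> set T | forall i, measurable (B i)]]
  (fun=> setT)) => //.
- apply/seteqP; split.
  + apply: smallest_sub; first exact: smallest_sigma_algebra.
    move=> B; rewrite -bigcup_seq => -[i _ [C mC <-]].
    apply: sub_sigma_algebra; exists (fun j => if j == i then C else setT).
      by move=> j /=; case: ifP.
    rewrite setTI; apply/seteqP; split=> t /=.
      by move=> /(_ i); rewrite eqxx.
    by move=> tC j; case: eqP => [->|].
  + apply: smallest_sub; first exact: sigma_algebra_measurable.
    by move=> _ [B mB <-]; exact: measurable_rectangle.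
- move=> _ _ [B mB <-] [C mC <-]; exists (fun i => B i `&` C i).
    by move=> i; exact: measurableI.
  apply/seteqP; split=> t /= => [h|[h1 h2] i]; last by split.
  by split=> i; have [] := h i.
- by move=> _; exists (fun=> setT) => //; apply/seteqP; split.
- by rewrite bigcup_const.
- by move=> _ [B mB <-]; exact: H.
- by move=> _; rewrite ltey_eq fin_num_measure.
Qed.

(** Enough to compare on rectangles, where the integral of the product density
    factorizes. *)
Lemma independent_coordinates_density (P : probability T R) (g : T -> R) n
    (mu : {finite_measure set (n.-tuple T) -> \bar R}) :
  measurable_fun setT g -> (forall x, 0 <= g x) ->
  P.-integrable setT (EFin \o g) ->
  (forall A : 'I_n -> set T, (forall i, measurable (A i)) ->
    mu (rectangle n A) = (\prod_(i < n) \int[P]_(x in A i) (g x)%:E)%E) ->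
  forall A, measurable A ->
  mu A = (\int[power_prob P n]_(t in A) (\prod_(i < n) g (tnth t i))%:E)%E.
Proof.
move=> mg g0 gi H.
have mG := measurable_prod_tnth n (fun=> g) (fun=> mg).
have G0 (t : n.-tuple T) : 0 <= \prod_(i < n) g (tnth t i) by rewrite prodr_ge0.
have Gi : (power_prob P n).-integrable setT
    (EFin \o (fun t : n.-tuple T => \prod_(i < n) g (tnth t i))).
  apply/integrableP; split; first exact/measurable_EFinP.
  under eq_integral do rewrite /= ger0_norm//.
  rewrite (ge0_integral_power_prob P n (fun=> g))//.
  apply: (@le_lt_trans _ _ (\prod_(i < n) (fine (\int[P]_x (g x)%:E))%:E)%E).
    by rewrite le_eqVlt; apply/orP; left; apply/eqP; apply: eq_bigr => i _;
      rewrite fineK// integrable_fin_num.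
  by rewrite prodEFin ltry.
apply: (rectangle_unique n mu (density_measure _ _ _ (power_prob P n) _ G0 Gi)).
move=> A mA; rewrite H//.
have indicE (S : Type) (B : set S) (h : S -> R) x :
    ((EFin \o h) \_ B) x = (h x * \1_B x)%:E.
  by rewrite patchE indicE; case: ifP => _; rewrite ?mulr1// mulr0.
transitivity (\prod_(i < n) \int[P]_x (g x * \1_(A i) x)%:E)%E.
  apply: eq_bigr => i _; rewrite integral_mkcond.
  by apply: eq_integral => x _; rewrite -indicE.
rewrite -(ge0_integral_power_prob P n (fun i x => g x * \1_(A i) x)); last 2 first.
- by move=> i; apply: measurable_funM => //; exact: measurable_indic.
- by move=> i x; rewrite mulr_ge0.
rewrite /density_measure [RHS]integral_mkcond; apply: eq_integral => t _.
by rewrite [RHS]indicE indic_rectangle big_split.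
Qed.

End power_prob.

(** * The law of the Brownian motion on the torus *)

Section circle_law.
Variable R : realType.
Local Notation mR := (measurableTypeR R).
Local Notation U := (uniform_prob (ltr0Sn R 1)).

Definition circle_theta (q : R) (c : circle R) : R :=
  theta q (generic_quotient.repr c).

Lemma circle_theta_proj (q x : R) : circle_theta q (circle_proj x) = theta q x.
Proof.
by apply/theta_periodic/circle_projP; rewrite /circle_proj generic_quotient.reprK.
Qed.

Lemma measurable_circle (A : set (circle R)) :
  measurable (circle_proj @^-1` A : set mR) -> measurable A.
Proof. by move=> mA; rewrite /measurable/= /image_set_system/= setTI. Qed.

Lemma measurable_circle_theta (q : R) : 0 <= q <= 1 / 2 ->
  measurable_fun setT (circle_theta q).
Proof.
move=> q0 _ Y mY; rewrite setTI; apply: measurable_circle.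
rewrite (_ : _ @^-1` _ = theta q @^-1` Y).
  by rewrite -[X in measurable X]setTI; apply: measurable_theta.
by apply/seteqP; split=> x /=; rewrite circle_theta_proj.
Qed.

(** The preimage of a subset of the circle is 2-periodic, hence unchanged by
    wrapping: the computation takes place on [0, 2[. *)
Lemma circle_law (s q : R) (A : set (circle R)) : s != 0 ->
  q = expR (- ((pi * s) ^+ 2 / 2)) -> q <= 1 / 4 -> measurable A ->
  normal_prob 0 s (circle_proj @^-1` A) =
  (\int[circle_uniform R]_(c in A) (circle_theta q c)%:E)%E.
Proof.
move=> s0 qE q4 mA.
have q02 : 0 <= q <= 1 / 2.
  have := expR_ge0 (- ((pi * s) ^+ 2 / 2)); rewrite -qE => q0.
  by rewrite q0/= (le_trans q4)//; lra.
have mA' : measurable (circle_proj @^-1` A : set mR).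
  by rewrite -[X in measurable X]setTI; exact: measurable_circle_proj.
rewrite -[in LHS](_ : wrap R @^-1` (circle_proj @^-1` A) = circle_proj @^-1` A);
  last first.
  by apply/seteqP; split=> x /=; rewrite circle_proj_wrap.
rewrite (wrapped_normal_density _ _ _ s0 qE q4)//.
rewrite ge0_integral_pushforward//.
- by apply: eq_integral => x _; rewrite /= circle_theta_proj.
- by apply/measurable_EFinP/measurable_funTS; exact: measurable_circle_theta.
- by move=> c _; rewrite lee_fin (theta_ge0 _ _ _ qE q4).
Qed.

End circle_law.
Arguments circle_theta {R}.

Section torus_law.
Context d (Omega : measurableType d) (R : realType) (P : probability Omega R).

Lemma eq_probability_ae (A B : set Omega) : measurable A -> measurable B ->
  (\forall w \ae P, A w <-> B w) -> P A = P B.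
Proof.
move=> mA mB [N [mN N0 AB]].
have le (C D : set Omega) : measurable C -> measurable D ->
    (forall w, ~ N w -> C w -> D w) -> (P C <= P D)%E.
  move=> mC mD CD; rewrite -[leRHS]adde0 -N0.
  apply: le_trans (measureU2 _ _ _) => //; apply: le_measure; rewrite ?inE//.
    exact: measurableU.
  by move=> w Cw; have [Nw|nNw] := pselect (N w); [right|left; exact: CD].
have AB' w : ~ N w -> (A w <-> B w).
  by move=> nNw; apply: contrapT => /AB.
by apply/eqP; rewrite eq_le !le//; move=> w /AB' [].
Qed.

(** Only the increment between the times 0 and t matters: its coordinates are
    independent Gaussians, and it is almost surely the position at time t. *)
Lemma torus_brownian_law n (X : R -> {RV P >-> torus R n}) (t q : R) :
  is_torus_brownian_motion X -> 0 < t -> q = expR (- (pi ^+ 2 / 2 * t)) ->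
  q <= 1 / 4 -> forall A, measurable A ->
  distribution P (X t) A =
  (\int[torus_uniform R n]_(x in A)
     (\prod_(i < n) circle_theta q (tnth x i))%:E)%E.
Proof.
move=> [B [B0 Bind Bnorm _] XB] t0 qE q4.
have st0 : Num.sqrt t != 0 by rewrite gt_eqF// sqrtr_gt0.
have qE' : q = expR (- ((pi * Num.sqrt t) ^+ 2 / 2)).
  by rewrite qE exprMn sqr_sqrtr ?ltW//; congr (expR (- _)); field.
have q02 : 0 <= q <= 1 / 2.
  have := expR_ge0 (- (pi ^+ 2 / 2 * t)); rewrite -qE => q0.
  by rewrite q0/= (le_trans q4)//; lra.
have th0 c : 0 <= circle_theta q c by exact: (theta_ge0 _ _ _ qE' q4).
have mth := measurable_circle_theta _ _ q02.
apply: independent_coordinates_density => //.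
  apply: bounded_integrable => //; exists 3 => c.
  by rewrite ger0_norm//; exact: (theta_le3 _ _ _ qE' q4).
move=> A mA; pose A' i : set (measurableTypeR R) := circle_proj @^-1` A i.
have mA' i : measurable (A' i).
  by rewrite -[X in measurable X]setTI; exact: measurable_circle_proj.
have mB i : measurable_fun setT (increment B 0 t i).
  apply: measurable_funB.
  - exact: (measurableT_comp (measurable_tnth i) (measurable_funP (B t))).
  - exact: (measurableT_comp (measurable_tnth i) (measurable_funP (B 0))).
transitivity (P (\bigcap_i (increment B 0 t i @^-1` A' i))).
  apply: eq_probability_ae.
  - rewrite -[X in measurable X]setTI; apply: (measurable_funP (X t)) => //.
    exact: measurable_rectangle.
  - apply: fin_bigcap_measurable => // i _.
    by rewrite -[X in measurable X]setTI; apply: mB => //; exact: mA'.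
  - apply: filterS B0 => w Bw; rewrite /rectangle /= XB ?ltW//.
    split=> h i => [_|]; have := h i; rewrite /A' /increment /= tnth_mktuple Bw subr0//.
    exact.
(* independence of the increments, for the one-step partition 0 < t *)
have t0' : 0 <= t *+ 0 by rewrite mulr0n.
have tinc : {homo (fun j => t *+ j) : i j / (i < j)%N >-> i < j}.
  by move=> i j ij /=; rewrite ltr_pMn2l.
have E (ji : 'I_1 * 'I_n) : increment B (t *+ ji.1) (t *+ ji.1.+1) ji.2 =
    increment B 0 t ji.2.
  by rewrite (ord1 ji.1) mulr0n mulr1n.
have H : P (\bigcap_(ji in [set: 'I_1 * 'I_n])
      (increment B (t *+ ji.1) (t *+ ji.1.+1) ji.2 @^-1` A' ji.2)) =
    (\prod_(ji : 'I_1 * 'I_n)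
       P (increment B (t *+ ji.1) (t *+ ji.1.+1) ji.2 @^-1` A' ji.2))%E.
  exact: (Bind 1%N (fun j => t *+ j) t0' tinc (fun ji => A' ji.2) (fun ji => mA' ji.2)).
have H1 : \bigcap_(ji in [set: 'I_1 * 'I_n])
      (increment B (t *+ ji.1) (t *+ ji.1.+1) ji.2 @^-1` A' ji.2) =
    \bigcap_i (increment B 0 t i @^-1` A' i).
  apply/seteqP; split=> w h i _; first by have := h (ord0, i) I; rewrite E.
  by have := h i.2 I; rewrite /= E.
rewrite -H1 H.
transitivity (\prod_(j < 1) \prod_(i < n) P (increment B 0 t i @^-1` A' i))%E.
  by rewrite pair_bigA /=; apply: eq_bigr => ji _; rewrite E.
rewrite big_ord1; apply: eq_bigr => i _.
rewrite (Bnorm 0 t i (A' i) (lexx 0) t0 (mA' i)) subr0.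
exact: circle_law.
Qed.

End torus_law.

(** * Separation discrepancy of a measure with a density *)

Section separation_density.
Context d (T : measurableType d) (R : realType) (mu nu : probability T R).
Variable g : T -> R.
Hypotheses (mg : measurable_fun setT g) (g0 : forall x, 0 <= g x).
Hypothesis muE :
  forall A, measurable A -> mu A = (\int[nu]_(x in A) (g x)%:E)%E.

Let mu_nu : mu `<< nu.
Proof. exact: (@dominates_density _ _ _ mu nu g mg muE). Qed.

(** Uniqueness of the Lebesgue decomposition: mu is absolutely continuous, so it
    ignores the null set N that carries the singular part of any decomposition,
    and the absolutely continuous part agrees with mu outside N. *)
Lemma ac_part_density (A : set T) : measurable A -> ac_part mu nu A = mu A.
Proof.
move=> mA.
have [sg [acnu [N [mN N0 sgN]] dec]] :
    exists sg, is_lebesgue_decomposition mu nu (ac_part mu nu) sg.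
  apply: (@xgetPex _ (mzero : {classic {finite_measure set T -> \bar R}})
    [set ac | exists sg, is_lebesgue_decomposition mu nu ac sg]).
  exists (mu : {finite_measure set T -> \bar R}),
    (mzero : {finite_measure set T -> \bar R}).
  split => //; last by move=> B mB; rewrite /= /mzero adde0.
  by exists set0; split.
have sg0 B : measurable B -> B `<=` ~` N -> sg B = 0%E.
  move=> mB BN; apply: subset_measure0 BN sgN => //; exact: measurableC.
have muN : mu N = 0%E by have /null_content_dominatesP := mu_nu; exact.
have acN : ac_part mu nu N = 0%E by have /null_content_dominatesP := acnu; exact.
have split (m : {finite_measure set T -> \bar R}) :
    m N = 0%E -> m A = m (A `\` N).
  move=> mN0; transitivity (m (A `\` N) + m (A `&` N))%E; first exact: measureDI.
  have -> : m (A `&` N) = 0%E; last by rewrite adde0.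
  by apply: subset_measure0 (@subIsetr _ A N) mN0 => //; exact: measurableI.
have -> : ac_part mu nu A = ac_part mu nu (A `\` N) by exact: split.
have -> : mu A = mu (A `\` N) by exact: (split mu).
rewrite dec; last exact: measurableD.
by rewrite sg0 ?adde0//; exact: measurableD.
Qed.

Lemma separation_density :
  separation mu nu = ess_sup nu (fun x => (1 - g x)%:E).
Proof.
have ac_nu : ac_part mu nu `<< nu.
  apply/null_content_dominatesP => A mA A0; rewrite ac_part_density//.
  by have /null_content_dominatesP := mu_nu; exact.
have ig := integrable_density _ _ _ mu nu g mg muE g0.
have : ae_eq nu setT (EFin \o g)
    (Radon_Nikodym (charge_of_finite_measure (ac_part mu nu)) nu).
  apply: integral_ae_eq => //.
  move=> E _ mE; transitivity (ac_part mu nu E).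
    by rewrite ac_part_density// muE.
  exact: (@Radon_Nikodym_integral _ _ _
    (charge_of_finite_measure (ac_part mu nu)) nu E ac_nu mE).
move=> ae; apply: eq_ess_sup; apply: filterS ae => x /(_ I) /= <-.
by [].
Qed.

End separation_density.

(** * Bounds on the separation discrepancy *)

Lemma ae_exists d (T : measurableType d) (R : realType)
    (nu : {measure set T -> \bar R}) (S : set T) (Q : T -> Prop) :
  measurable S -> (0 < nu S)%E -> (\forall x \ae nu, Q x) ->
  exists2 x, S x & Q x.
Proof.
move=> mS S0 [N [mN N0 QN]]; apply: contrapT => h.
have SN : S `<=` N by move=> x Sx; apply: QN => /= Qx; apply: h; exists x.
by have := subset_measure0 mS mN SN N0 => SE; rewrite SE ltxx in S0.
Qed.

Section torus_separation.
Context d (Omega : measurableType d) (R : realType) (P : probability Omega R).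
Local Notation mR := (measurableTypeR R).
Local Notation U := (uniform_prob (ltr0Sn R 1)).

Lemma uniform_near_one_gt0 (A : set mR) : measurable A ->
  (\forall x \near (1 : R), A x) -> (0 < U A)%E.
Proof.
move=> mA /nbhs_ballP[e /= e0 eA].
pose r := Num.min (e / 2) 1.
have r0 : 0 < r by rewrite lt_min divr_gt0//= ltr01.
have re : r < e by rewrite gt_min ltr_pdivrMr// ltr_pMr// ltr1n.
have r1 : r <= 1 by rewrite ge_min lexx orbT.
pose I : set mR := `[1 - r, 1 + r]%classic.
have mI : measurable I by exact: measurable_itv.
have IA : I `<=` A.
  move=> x; rewrite /I /= in_itv/= => /andP[x1 x2]; apply: eA.
  by rewrite /ball/= distrC ltr_norml; apply/andP; split; lra.
apply: lt_le_trans (le_measure U (mem_set mI) (mem_set mA) IA).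
change (0 < \int[lebesgue_measure]_(x in I) (uniform_pdf 0 2%:R x)%:E)%E.
rewrite (eq_integral (fun=> (2^-1)%:E)); last first.
  move=> x; rewrite inE /I/= in_itv/= => /andP[x1 x2].
  rewrite /uniform_pdf ifT ?subr0//; apply/andP; split; lra.
rewrite /I integral_cst//= lebesgue_measure_itv/= lte_fin ifT; last lra.
by rewrite -EFinD -EFinM lte_fin mulr_gt0//; lra.
Qed.

(** The upper bound holds because every factor of the density is at least
    1 - 2 q - 4 q^2. For the lower bound, the set C of points of the circle
    where theta <= 1 - 2 q + 6 q^2 is a neighbourhood of 1, so the points with
    all coordinates in C have positive measure, and one of them obeys the
    almost sure bound by the essential supremum. *)
Lemma torus_separation_bounds n (X : R -> {RV P >-> torus R n}) (t q : R) :
  is_torus_brownian_motion X -> 0 < t -> q = expR (- (pi ^+ 2 / 2 * t)) ->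
  q <= 1 / 8 ->
  ((1 - (1 - 2 * q + 6 * q ^+ 2) ^+ n)%:E <=
   separation (distribution P (X t)) (torus_uniform R n) <=
   (1 - (1 - 2 * q - 4 * q ^+ 2) ^+ n)%:E)%E.
Proof.
move=> hX t0 qE q8.
have q0 : 0 < q by rewrite qE expR_gt0.
have q4 : q <= 1 / 4 by rewrite (le_trans q8)//; lra.
have q02 : 0 <= q <= 1 / 2 by rewrite ltW//= (le_trans q4)//; lra.
have mth := measurable_circle_theta _ _ q02.
have lb c : 1 - 2 * q - 4 * q ^+ 2 <= circle_theta q c.
  have := theta_bound _ _ q02 (generic_quotient.repr c).
  rewrite ler_norml => /andP[+ _]; rewrite /circle_theta.
  have := cos_geN1 (pi * generic_quotient.repr c); nra.
have l0 : 0 <= 1 - 2 * q - 4 * q ^+ 2 by nra.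
have th0 c : 0 <= circle_theta q c by exact: le_trans (lb c).
have mg := measurable_prod_tnth _ (circle R) _ n (fun=> circle_theta q) (fun=> mth).
rewrite (separation_density _ _ _ _ _ _ mg); last 2 first.
- by move=> x; rewrite prodr_ge0.
- by apply: torus_brownian_law.
apply/andP; split; last first.
  apply/ess_supP/aeW => x; rewrite lee_fin lerB//.
  rewrite -[X in _ ^+ X](card_ord n) -prodr_const.
  by apply: ler_prod => i _; rewrite l0 lb.
pose C : set (circle R) := [set c | circle_theta q c <= 1 - 2 * q + 6 * q ^+ 2].
have mC : measurable C.
  rewrite (_ : C = circle_theta q @^-1` `]-oo, 1 - 2 * q + 6 * q ^+ 2]).
    by rewrite -[X in measurable X]setTI; exact: mth.
  by apply/seteqP; split=> c; rewrite /C/= in_itv.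
have C0 : (0 < circle_uniform R C)%E.
  apply: uniform_near_one_gt0.
    by rewrite -[X in measurable X]setTI; exact: measurable_circle_proj.
  (* near 1 the cosine is below q - 1, hence theta <= 1 - 2 q + 2 q^2 + 4 q^2 *)
  have cc : (fun x : R => cos (pi * x)) x @[x --> (1 : R)] --> (-1 : R).
    rewrite -cospi -[X in cos X]mulr1.
    apply: continuous_comp; last exact: continuous_cos.
    by apply: cvgM; [exact: cvg_cst|exact: cvg_id].
  have /cvgrPdist_lt /(_ _ q0) := cc; apply: filterS => x.
  rewrite ltr_norml => /andP[? ?]; rewrite /C/= circle_theta_proj.
  by have := theta_bound _ _ q02 x; rewrite ler_norml => /andP[_]; nra.
pose S := rectangle _ (circle R) n (fun=> C).
have S0 : (0 < torus_uniform R n S)%E.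
  have -> : torus_uniform R n S = (\prod_(i < n) circle_uniform R C)%E.
    transitivity (\int[torus_uniform R n]_x (\1_S x)%:E)%E.
      by rewrite integral_indic ?setIT//; exact: measurable_rectangle.
    under eq_integral do rewrite indic_rectangle.
    rewrite (ge0_integral_power_prob _ _ _ (circle_uniform R) n (fun=> \1_C))//.
    by apply: eq_bigr => i _; rewrite integral_indic ?setIT.
  by elim/big_ind : _ => // x y; exact: mule_gt0.
have [x Sx /= le] := ae_exists _ _ _ (torus_uniform R n) S _
  (measurable_rectangle _ _ _ _ (fun=> mC)) S0 (ess_sup_ge (torus_uniform R n)
  (fun x => (1 - \prod_(i < n) circle_theta q (tnth x i))%:E)).
apply: le_trans le; rewrite lee_fin lerB//.
rewrite -[X in _ ^+ X](card_ord n) -prodr_const.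
by apply: ler_prod => i _; rewrite th0; exact: Sx.
Qed.

End torus_separation.

(** * Asymptotics *)

Section asymptotics.
Variable R : realType.

Lemma expR_le_inv1B (z : R) : z < 1 -> expR z <= (1 - z)^-1.
Proof.
move=> z1; rewrite -[expR z]invrK lef_pV2 ?posrE ?invr_gt0 ?expR_gt0 ?subr_gt0//.
by rewrite -expRN expR_ge1Dx.
Qed.

(** From 1 / (1 - y) = 1 + y / (1 - y) <= exp(y / (1 - y)). *)
Lemma expR_le_1B (y : R) : 0 <= y <= 1 / 2 -> expR (- (y + 2 * y ^+ 2)) <= 1 - y.
Proof.
move=> /andP[y0 y2]; rewrite expRN.
have y1 : 0 < 1 - y by lra.
rewrite -[leRHS]invrK lef_pV2 ?posrE ?invr_gt0 ?expR_gt0//.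
apply: le_trans (expR_ge1Dx _).
rewrite -(ler_pM2r y1) mulVf ?gt_eqF//; nra.
Qed.

Definition limit_separation (c : R) : R :=
  1 - expR (- 2 * expR (- (pi ^+ 2 / 2) * c)).

(** Since n q = lam, the powers lie between exp(- 2 lam - 20 lam^2 / n) and
    exp(- 2 lam + 6 lam^2 / n). The hypotheses on n give q <= 1/8 and
    6 lam^2 / n <= 1/2, which make the elementary bounds on exp available. *)
Lemma power_bounds (lam L : R) (n : nat) : 0 < lam <= L -> 8 * L <= n%:R ->
  12 * L ^+ 2 <= n%:R -> 0 < n%:R :> R ->
  let q := lam / n%:R in
  (1 - 2 * q + 6 * q ^+ 2) ^+ n <= expR (- 2 * lam) + 20 * L ^+ 2 / n%:R /\
  expR (- 2 * lam) - 20 * L ^+ 2 / n%:R <= (1 - 2 * q - 4 * q ^+ 2) ^+ n.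
Proof.
move=> /andP[l0 lL] n8 n12 n0 q.
have q0 : 0 < q by rewrite divr_gt0.
have q8 : q <= 1 / 8 by rewrite ler_pdivrMr//; lra.
have nq : n%:R * q = lam by rewrite /q mulrCA mulfV ?mulr1 ?gt_eqF.
have qL : n%:R * q ^+ 2 <= L ^+ 2 / n%:R.
  rewrite expr2 mulrA nq /q mulrA -expr2 ler_pM2r ?invr_gt0//.
  by rewrite ler_sqr// nnegrE ltW// (lt_le_trans l0).
have e1 : expR (- 2 * lam) <= 1 by rewrite expR_le1; lra.
have e0 := expR_gt0 (- 2 * lam).
split.
- apply: (@le_trans _ _ (expR (- 2 * q + 6 * q ^+ 2) ^+ n)).
    apply: lerXn2r; rewrite ?nnegrE ?expR_ge0//; first by nra.
    by have := expR_ge1Dx (- 2 * q + 6 * q ^+ 2); lra.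
  rewrite -expRM_natl mulrDr (mulrCA _ (-2)) nq (mulrCA _ 6) expRD.
  set z := n%:R * q ^+ 2.
  have z6 : 6 * z <= 1 / 2.
    have : L ^+ 2 / n%:R <= 1 / 12 by rewrite ler_pdivrMr//; lra.
    by rewrite /z; lra.
  have z0 : 0 <= z by rewrite mulr_ge0 ?sqr_ge0// ltW.
  have : expR (6 * z) <= 1 + 12 * z.
    apply: le_trans (expR_le_inv1B _ _) _; first by lra.
    rewrite -[leRHS]invrK lef_pV2 ?posrE ?invr_gt0; last 2 first.
    - lra.
    - lra.
    have h : 0 < 1 + 12 * z by lra.
    rewrite -(ler_pM2r h) mulVf ?gt_eqF//; nra.
  rewrite -mulrA -/z; have := qL; rewrite -/z; nra.
- have [y yE] : exists y, y = 2 * q + 4 * q ^+ 2 by eexists.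
  have y5 : y <= 5 / 2 * q by rewrite yE; nra.
  have y0 : 0 <= y by rewrite yE; nra.
  have y2 : 0 <= y <= 1 / 2 by rewrite y0/=; lra.
  have yq : y + 2 * y ^+ 2 <= 2 * q + 20 * q ^+ 2.
    have : y ^+ 2 <= (5 / 2 * q) ^+ 2 by rewrite ler_sqr// nnegrE; lra.
    have -> : (5 / 2 * q) ^+ 2 = 25 / 4 * q ^+ 2 by field.
    have := sqr_ge0 q; lra.
  apply: (@le_trans _ _ (expR (- (2 * q + 20 * q ^+ 2)) ^+ n)); last first.
    apply: lerXn2r; rewrite ?nnegrE ?expR_ge0//; first by nra.
    rewrite (_ : 1 - 2 * q - 4 * q ^+ 2 = 1 - y); last by rewrite yE; ring.
    by apply: le_trans (expR_le_1B _ y2); rewrite ler_expR lerN2.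
  rewrite -expRM_natl
    (_ : n%:R * - _ = - 2 * lam + - (20 * (n%:R * q ^+ 2))); last first.
    by rewrite -nq; ring.
  rewrite expRD.
  have := expR_ge1Dx (- (20 * (n%:R * q ^+ 2))).
  have : 0 <= n%:R * q ^+ 2 by rewrite mulr_ge0 ?sqr_ge0// ltW.
  have := qL; rewrite -!mulrA; nra.
Qed.

End asymptotics.
Arguments limit_separation {R}.

Section torus_separation_estimate.
Context d (Omega : measurableType d) (R : realType) (P : probability Omega R).

(** For these n one has q <= 1/8 < 1, so the time 2 log n / pi^2 + c is
    positive and the law has the theta density. *)
Lemma torus_separation_estimate n (X : R -> {RV P >-> torus R n}) (L c : R) :
  is_torus_brownian_motion X -> (0 < n)%N ->
  expR (- (pi ^+ 2 / 2) * c) <= L -> 8 * L <= n%:R -> 12 * L ^+ 2 <= n%:R ->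
  exists2 r : R,
    separation (distribution P (X (2 * ln n%:R / pi ^+ 2 + c)))
      (torus_uniform R n) = r%:E &
    `|r - limit_separation c| <= 20 * L ^+ 2 / n%:R.
Proof.
move=> hX n0' lL n8 n12.
have n0 : 0 < n%:R :> R by rewrite ltr0n.
have p0 : pi != 0 :> R by rewrite gt_eqF// pi_gt0.
set lam := expR (- (pi ^+ 2 / 2) * c) in lL *.
have l0 : 0 < lam by rewrite expR_gt0.
set t := _ + c; pose q := lam / n%:R.
have qE : q = expR (- (pi ^+ 2 / 2 * t)).
  rewrite (_ : - (pi ^+ 2 / 2 * t) = - (pi ^+ 2 / 2) * c - ln n%:R).
    by rewrite expRB lnK// posrE.
  by move: p0; rewrite /t; move: (@pi R) => p p0; field.
have q8 : q <= 1 / 8 by rewrite ler_pdivrMr//; lra.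
have t0 : 0 < t.
  have : expR (- (pi ^+ 2 / 2 * t)) < 1 by rewrite -qE; lra.
  by rewrite expR_lt1 oppr_lt0 pmulr_rgt0// divr_gt0// exprn_gt0// pi_gt0.
have lL' : 0 < lam <= L by rewrite l0.
have [b1 b2] := power_bounds _ _ _ _ lL' n8 n12 n0.
have /andP[s1 s2] := torus_separation_bounds _ _ _ P n X t q hX t0 qE q8.
have sf : separation (distribution P (X t)) (torus_uniform R n) \is a fin_num.
  rewrite fin_numE; apply/andP; split; apply/eqP => E.
    by have := lt_le_trans (ltNyr _) s1; rewrite E ltxx.
  by have := le_lt_trans s2 (ltry _); rewrite E ltxx.
exists (fine (separation (distribution P (X t)) (torus_uniform R n))).
  by rewrite fineK.
move: s1 s2; rewrite -(fineK sf) !lee_fin /= => s1 s2.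
rewrite /limit_separation -/lam ler_norml; apply/andP; split; lra.
Qed.

End torus_separation_estimate.

Section limit_separation.
Variable R : realType.

Lemma limit_separation_gt0 (c : R) : 0 < limit_separation c.
Proof.
by rewrite subr_gt0 expR_lt1 mulNr oppr_lt0 mulr_gt0// expR_gt0.
Qed.

Lemma limit_separation_lt1 (c : R) : limit_separation c < 1.
Proof. by rewrite ltrBlDr ltrDl expR_gt0. Qed.

Lemma limit_separation_decreasing (c c' : R) : c <= c' ->
  limit_separation c' <= limit_separation c.
Proof.
move=> cc'; rewrite lerB// ler_expR ler_wnM2l// ler_expR ler_wnM2l//.
by rewrite oppr_le0 divr_ge0// sqr_ge0.
Qed.

Let k : R := pi ^+ 2 / 2.
Let k0 : 0 < k.
Proof. by rewrite divr_gt0// exprn_gt0// pi_gt0. Qed.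

Lemma limit_separation_cvgy : limit_separation r @[r --> +oo] --> (0 : R).
Proof.
have h : expR (- (k * r)) @[r --> +oo] --> (0 : R).
  apply: (cvg_comp (fun r => k * r) (fun x => expR (- x)) _ (@cvgr_expR R)).
  exact: gt0_cvgMry.
have h2 : - 2 * expR (- (pi ^+ 2 / 2) * r) @[r --> +oo] --> (0 : R).
  rewrite -[0](mulr0 (- 2 : R)); apply: cvgM; first exact: cvg_cst.
  by under eq_cvg do rewrite mulNr.
have h3 : expR (- 2 * expR (- (pi ^+ 2 / 2) * r)) @[r --> +oo] --> (1 : R).
  by have := cvg_comp _ _ h2 (@continuous_expR R 0); rewrite expR0.
by rewrite /limit_separation -[0](subrr (1 : R)); apply: cvgB h3; exact: cvg_cst.
Qed.

Lemma limit_separation_cvgNy : limit_separation (- r) @[r --> +oo] --> (1 : R).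
Proof.
suff h : expR (- 2 * expR (- (pi ^+ 2 / 2) * - r)) @[r --> +oo] --> (0 : R).
  by rewrite /limit_separation -[X in _ --> X]subr0; apply: cvgB h; exact: cvg_cst.
apply: (@squeeze_cvgr _ _ _ _ (cst 0) (fun r : R => (2 * (1 + k * r))^-1)).
- near=> r; rewrite expR_ge0/= mulNr expRN lef_pV2 ?posrE ?expR_gt0//; last first.
    have r0 : 0 < r by near: r; exact: nbhs_pinfty_gt.
    by rewrite mulr_gt0// addr_gt0// mulr_gt0.
  apply: (@le_trans _ _ (2 * expR (- k * - r))).
    by rewrite ler_pM2l// mulrNN expR_ge1Dx.
  by apply: le_trans (expR_ge1Dx _); rewrite lerDr.
- exact: cvg_cst.
- apply/gtr0_cvgV0.
    near=> r; have r0 : 0 < r by near: r; exact: nbhs_pinfty_gt.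
    by rewrite mulr_gt0// addr_gt0// mulr_gt0.
  apply/cvgryPge => A; near=> r.
  have : `|A| / k <= r by near: r; apply: nbhs_pinfty_ge; exact: num_real.
  rewrite ler_pdivrMr// => h; have := ler_norm A; have := normr_ge0 A.
  have := mulrC r k; lra.
Unshelve. all: by end_near. Qed.

Lemma expR_le_of_norm (M c : R) : `|c| <= M ->
  expR (- (pi ^+ 2 / 2) * c) <= expR (k * M).
Proof.
rewrite ler_norml => /andP[cM _]; rewrite ler_expR mulNr -mulrN.
by rewrite ler_pM2l// lerNl.
Qed.

Lemma ln_littleo : (fun=> 1 : R) =o_\oo (fun n : nat => 2 * ln n%:R / pi ^+ 2 : R).
Proof.
apply/eqoP => e e0 /=.
near=> n; rewrite normr1.
have p2 : 0 < pi ^+ 2 :> R by rewrite exprn_gt0// pi_gt0.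
have nM : expR (pi ^+ 2 / (2 * e)) <= n%:R by near: n; exact: nbhs_infty_ger.
have n0 : 0 < n%:R :> R by rewrite (lt_le_trans (expR_gt0 _) nM).
have lnM : pi ^+ 2 / (2 * e) <= ln n%:R.
  by rewrite -[leLHS]expRK ler_ln ?posrE ?expR_gt0.
rewrite mulrC -ler_pdivrMr// div1r; apply: le_trans (ler_norm _).
rewrite ler_pdivlMr//; move: lnM; move: (pi ^+ 2 : R) => p lnM.
rewrite (_ : e^-1 * p = 2 * (p / (2 * e))); last by field; rewrite gt_eqF.
by rewrite ler_pM2l.
Unshelve. all: by end_near. Qed.

End limit_separation.

(** The bound L on exp(- pi^2 c / 2) makes the estimate uniform in c; a compact
    set of c provides such a bound. Then both the inferior and the superior limits
    in the definition of the window are values of the limit function. *)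
Theorem theorem10 (R : realType) (d : nat -> measure_display)
    (Omega : forall n, measurableType (d n))
    (P : forall n, probability (Omega n) R)
    (B : forall n, R -> {RV (P n) >-> torus R n})
    (hB : forall n, (0 < n)%N -> is_torus_brownian_motion (B n)) :
  let law n t : probability (torus R n) R := distribution (P n) (B n t) in
  let sep n t := separation (law n t) (torus_uniform R n) in
  let a n : R := 2 * ln n%:R / pi ^+ 2 in
  let limit (c : R) : R := 1 - expR (- 2 * expR (- (pi ^+ 2 / 2) * c)) in
  [/\ forall c : R, sep n (a n + c) @[n --> \oo] --> (limit c)%:E,
      forall K : set R, compact K -> forall e : R, 0 < e ->
        \forall n \near \oo, forall c : R, K c ->
          (`|sep n (a n + c)%R - (limit c)%:E| < e%:E)%E &
      strongly_optimal_window law (torus_uniform R) a (fun=> 1)].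
Proof.
move=> law sep a limit.
have key L e : 0 < e -> \forall n \near \oo, forall c,
    expR (- (pi ^+ 2 / 2) * c) <= L ->
    exists2 r, sep n (a n + c) = r%:E & `|r - limit c| < e.
  move=> e0; near=> n => c cL.
  have n0 : (0 < n)%N by near: n; exact: nbhs_infty_gt.
  have n0' : 0 < n%:R :> R by rewrite ltr0n.
  have n8 : 8 * L <= n%:R by near: n; exact: nbhs_infty_ger.
  have n12 : 12 * L ^+ 2 <= n%:R by near: n; exact: nbhs_infty_ger.
  have ne : 20 * L ^+ 2 / e < n%:R by near: n; exact: nbhs_infty_gtr.
  have [r rE rc] := torus_separation_estimate _ _ _ (P n) n (B n) L c
    (hB n n0) n0 cL n8 n12.
  exists r; first exact: rE.
  apply: le_lt_trans rc _; by move: ne; rewrite !ltr_pdivrMr// (mulrC e).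
have cvg_sep c : sep n (a n + c) @[n --> \oo] --> (limit c)%:E.
  apply/fine_cvgP; split.
    have := key (expR (- (pi ^+ 2 / 2) * c)) _ ltr01.
    by apply: filterS => n /(_ c (lexx _)) [r -> _].
  apply/cvgrPdist_lt => e e0; have := key (expR (- (pi ^+ 2 / 2) * c)) _ e0.
  by apply: filterS => n /(_ c (lexx _)) [r /= -> rc]; rewrite distrC.
have cutoff : separation_cutoff law (torus_uniform R) a (fun=> 1).
  split.
  - exact: ln_littleo.
  - rewrite (_ : (fun r => _) = fun r => (limit r)%:E).
      by apply: cvg_EFin; [exact: nearW|exact: limit_separation_cvgy].
    apply/funext => r; have [_] := cvg_limn_einf_sup (cvg_sep r).
    by under eq_fun do rewrite -[X in a _ + X](mulr1 r).
  - rewrite (_ : (fun r => _) = fun r => (limit (- r))%:E).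
      by apply: cvg_EFin; [exact: nearW|exact: limit_separation_cvgNy].
    apply/funext => r; have [+ _] := cvg_limn_einf_sup (cvg_sep (- r)).
    by under eq_fun do rewrite -[X in a _ - X](mulr1 r).
split.
- exact: cvg_sep.
- move=> K /compact_bounded [M [_ KM]] e e0.
  have := key (expR (pi ^+ 2 / 2 * (`|M| + 1))) e e0.
  apply: filterS => n nc c Kc.
  have cM : `|c| <= `|M| + 1.
    by apply: KM => //; rewrite (le_lt_trans (ler_norm M))// ltrDl.
  by have [r -> rc] := nc c (expR_le_of_norm _ _ _ cM); rewrite -EFinB lte_fin.
- split=> // r r0.
  have cy := cvg_limn_einf_sup (cvg_sep r).
  have cNy := cvg_limn_einf_sup (cvg_sep (- r)).
  have Ey : (fun n => separation (law n (a n + r * 1)) (torus_uniform R n)) =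
     (fun n => sep n (a n + r)) by apply/funext => n; rewrite mulr1.
  have ENy : (fun n => separation (law n (a n - r * 1)) (torus_uniform R n)) =
     (fun n => sep n (a n - r)) by apply/funext => n; rewrite mulr1.
  rewrite Ey ENy cy.1 cNy.2; split.
  + by rewrite lte_fin limit_separation_gt0.
  + by rewrite lee_fin limit_separation_decreasing// ge0_cp// ltW.
  + by rewrite lte_fin limit_separation_lt1.
Unshelve. all: by end_near. Qed.
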